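(* Let $m\ge 2$ and $c>0$. For all integers $N\ge 0$, $k\ge 0$ and $1\le i\le d_k$, the odd Clifford prolate spheroidal wave function $\psi_{2N+1,m}^{k,c,i}$ is an eigenfunction of both $QP_c$ and $\mathcal{G}_c$: there are $\lambda,\mu\in\mathbb{C}$ with $QP_c\psi_{2N+1,m}^{k,c,i}=\lambda\,\psi_{2N+1,m}^{k,c,i}$ and $\mathcal{G}_c\psi_{2N+1,m}^{k,c,i}=\mu\,\psi_{2N+1,m}^{k,c,i}$ on $B(1)$.
   Context: $\mathbb{R}_m$ (resp. $\mathbb{C}_m$) is the real (resp. complex) Clifford algebra generated by $e_1,\dots,e_m$ with $e_j^2=-1$, $e_ie_j=-e_je_i$ ($i\ne j$). A point $x\in\mathbb{R}^m$ is identified with $\sum_j e_jx_j$, so $x^2=-|x|^2$; $\langle x,y\rangle=\sum_j x_jy_j$ for vectors. Clifford conjugation $\lambda\mapsto\bar\lambda$ is the conjugate-linear anti-automorphism of $\mathbb{C}_m$ with $\overline{e_j}=-e_j$; $[\lambda]_0$ is the scalar part and $|\lambda|^2=[\bar\lambda\lambda]_0$. The Dirac operator is $\partial_x=\sum_j e_j\partial_{x_j}$ (acting from the left). $B(r)$ is the closed ball of radius $r$ centred at $0$ in $\mathbb{R}^m$. For $c\ge0$, $L_cf(x)=\partial_x\big((1-|x|^2)\partial_xf(x)\big)+4\pi^2c^2|x|^2f(x)$ on $B(1)$. $M_l^+(k)$ is the right $\mathbb{R}_m$-module of $\mathbb{R}_m$-valued polynomials on $\mathbb{R}^m$ that are homogeneous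 of degree $k$ and left monogenic ($\partial_xY=0$); it has rank $d_k=\frac{(m+k-2)!}{(m-2)!\,k!}$. Fix a basis $\{Y_k^i\}_{i=1}^{d_k}$ of it with $\int_{S^{m-1}}\overline{Y_k^i(\omega)}Y_k^j(\omega)\,d\omega=\delta_{ij}$. Odd CPSWFs: the real numbers $\chi$ for which there is a nonzero $Q\in C^\infty([0,1],\mathbb{R})$ with $L_c[xQ(|x|^2)Y_k^i(x)]=\chi\, xQ(|x|^2)Y_k^i(x)$ on $B(1)$ do not depend on $i$ and form a strictly increasing sequence $\chi_{1,m}^{k,c}<\chi_{3,m}^{k,c}<\cdots$; for $\chi=\chi_{2N+1,m}^{k,c}$ the function $Q=Q_{N,m}^{k,c}$ is unique up to a real factor, and $\psi_{2N+1,m}^{k,c,i}(x)=xQ_{N,m}^{k,c}(|x|^2)Y_k^i(x)$, normalised in $L^2(B(1))$ and extended by $0$ outside $B(1)$. Operators: $\mathcal{F}f(\xi)=\int_{\mathbb{R}^m}e^{-2\pi i\langle x,\xi\rangle}f(x)\,dx$; $Qf=\chi_{B(1)}f$ (space-limiting operator; not to be confused with the functions $Q_{N,m}^{k,c}$); $P_cf(x)=\int_{B(c)}\mathcal{F}f(\xi)e^{2\pi i\langle\xi,x\rangle}\,d\xi$; $\mathcal{G}_cf(x)=\chi_{B(1)}(x)\int_{B(1)}e^{2\pi ic\langle x,y\rangle}f(y)\,dy$ (in the exponents $i$ is the imaginary unit; $\chi_{B(1)}$ is the indicator function). *)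

(* Defs.v *)
From HB Require Import structures.
From mathcomp Require Import all_boot all_order all_algebra.
From mathcomp Require Import ring.

Set Implicit Arguments.
Unset Strict Implicit.
Unset Printing Implicit Defensive.

Import Order.TTheory GRing.Theory Num.Theory.

Local Open Scope ring_scope.

(* The Clifford algebra over K with generators e_0, ..., e_(m-1), e_j^2 = -1,
   e_i e_j = - e_j e_i.  An element is the family of its coordinates in the
   basis e_A = e_(a_1) ... e_(a_r), for A = {a_1 < ... < a_r} : {set 'I_m}. *)
Definition clifford (K : comNzRingType) (m : nat) : Type :=
  {ffun {set 'I_m} -> K^o}.

Definition setsymd (T : finType) (A B : {set T}) : {set T} :=
  (A :\: B) :|: (B :\: A).

Section CliffordAlgebra.
Context (K : comNzRingType) (m : nat).
Implicit Types (A B C : {set 'I_m}) (x y z : clifford K m).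

HB.instance Definition _ := GRing.Lmodule.copy (clifford K m)
  {ffun {set 'I_m} -> K^o}.

Definition cl_coef x A : K := x A.

Definition cl_mk (g : {set 'I_m} -> K) : clifford K m := [ffun A => g A].

(* e_A e_B = cl_sign A B e_(A symdiff B): moving the factors of e_B into place
   gives one sign for each pair a in A, b in B with b < a (anticommutation) and
   one for each pair with b = a (from e_a^2 = -1). *)
Definition cl_sign A B : K :=
  \prod_(a in A) \prod_(b in B | (b <= a)%N) (-1).

Definition cl_mul x y : clifford K m :=
  cl_mk (fun C => \sum_A cl_sign A (setsymd A C)
                    * (cl_coef x A * cl_coef y (setsymd A C))).

Definition cl_one : clifford K m := cl_mk (fun A => (A == set0)%:R).

Lemma cl_mkE g A : cl_coef (cl_mk g) A = g A.
Proof. by rewrite /cl_coef ffunE. Qed.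

Lemma cl_ext x y : cl_coef x =1 cl_coef y -> x = y.
Proof. by move=> exy; apply/ffunP. Qed.

Lemma cl_coefD x y A : cl_coef (x + y) A = cl_coef x A + cl_coef y A.
Proof. by rewrite /cl_coef ffunE. Qed.

Lemma cl_coefN x A : cl_coef (- x) A = - cl_coef x A.
Proof. by rewrite /cl_coef ffunE. Qed.

Lemma cl_coef0 A : cl_coef 0 A = 0.
Proof. by rewrite /cl_coef ffunE. Qed.

Lemma cl_coefZ (k : K) x A : cl_coef (k *: x) A = k * cl_coef x A.
Proof. by rewrite /cl_coef ffunE. Qed.

Lemma in_setsymd (T : finType) (A B : {set T}) a :
  (a \in setsymd A B) = (a \in A) (+) (a \in B).
Proof. by rewrite !inE; do 2 case: (_ \in _). Qed.

Lemma setsymdA : associative (@setsymd 'I_m).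
Proof. by move=> A B C; apply/setP => a; rewrite !in_setsymd addbA. Qed.

Lemma setsymdC : commutative (@setsymd 'I_m).
Proof. by move=> A B; apply/setP => a; rewrite !in_setsymd addbC. Qed.

Lemma setsymdK A : involutive (setsymd A).
Proof. by move=> B; apply/setP => a; rewrite !in_setsymd addKb. Qed.

Lemma setsymd0 A : setsymd A set0 = A.
Proof. by apply/setP => a; rewrite in_setsymd inE addbF. Qed.

Lemma setsym0d A : setsymd set0 A = A.
Proof. by rewrite setsymdC setsymd0. Qed.

Lemma setsymdv A : setsymd A A = set0.
Proof. by apply/setP => a; rewrite in_setsymd inE addbb. Qed.

Lemma prod_setsymd (F : 'I_m -> K) A B : (forall a, F a * F a = 1) ->
  \prod_(a in setsymd A B) F a = \prod_(a in A) F a * \prod_(a in B) F a.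
Proof.
move=> F1; rewrite !(big_mkcond (fun a => a \in _)) -big_split /=.
apply: eq_bigr => a _; rewrite in_setsymd.
by do 2 case: (_ \in _); rewrite /= ?mulr1 ?mul1r ?F1.
Qed.

Lemma cl_signDl A B C :
  cl_sign (setsymd A B) C = cl_sign A C * cl_sign B C.
Proof.
apply: prod_setsymd => a; rewrite -big_split /= big1 // => b _.
by rewrite mulrNN mulr1.
Qed.

Lemma cl_signDr A B C :
  cl_sign A (setsymd B C) = cl_sign A B * cl_sign A C.
Proof.
rewrite /cl_sign -big_split; apply: eq_bigr => a _ /=.
rewrite !big_mkcondr; apply: prod_setsymd => b.
by case: ifP; rewrite ?mulrNN mulr1.
Qed.

Lemma cl_sign0l A : cl_sign set0 A = 1.
Proof. by rewrite /cl_sign big1 // => a; rewrite inE. Qed.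

Lemma cl_sign0r A : cl_sign A set0 = 1.
Proof.
by rewrite /cl_sign big1 // => a _; rewrite big1 // => b; rewrite inE.
Qed.

Lemma cl_signV A B : cl_sign A B * cl_sign A B = 1.
Proof. by rewrite -cl_signDr setsymdv cl_sign0r. Qed.

Lemma cl_mulE x y C : cl_coef (cl_mul x y) C =
  \sum_A cl_sign A (setsymd A C) * (cl_coef x A * cl_coef y (setsymd A C)).
Proof. exact: cl_mkE. Qed.

Fact cl_mulA : associative cl_mul.
Proof.
move=> x y z; apply: cl_ext => D; rewrite !cl_mulE.
under [RHS]eq_bigr => C _ do rewrite cl_mulE mulr_suml mulr_sumr.
rewrite exchange_big /=; apply: eq_bigr => A _.
rewrite cl_mulE !mulr_sumr.
rewrite [RHS](reindex_inj (can_inj (setsymdK A))) /=.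
apply: eq_bigr => B _; rewrite !setsymdK.
have -> : setsymd (setsymd A B) D = setsymd B (setsymd A D).
  by rewrite (setsymdC A B) setsymdA.
set E := setsymd B (setsymd A D).
have -> : setsymd A D = setsymd B E by rewrite setsymdK.
rewrite cl_signDr cl_signDl.
set s1 := cl_sign A B; set s2 := cl_sign A E; set s3 := cl_sign B E.
ring.
Qed.

Fact cl_mul1x : left_id cl_one cl_mul.
Proof.
move=> x; apply: cl_ext => C; rewrite cl_mulE (bigD1 set0) //= big1 => [|A A0].
  by rewrite cl_mkE eqxx cl_sign0l setsym0d !mul1r addr0.
by rewrite cl_mkE (negPf A0) mul0r mulr0.
Qed.

Fact cl_mulx1 : right_id cl_one cl_mul.
Proof.
move=> x; apply: cl_ext => C; rewrite cl_mulE (bigD1 C) //= big1 => [|A AC].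
  by rewrite setsymdv cl_mkE eqxx cl_sign0r mul1r mulr1 addr0.
rewrite cl_mkE (_ : setsymd A C == set0 = false) ?mulr0 //.
apply/negbTE; apply: contra AC => /eqP AC0.
by rewrite -[C](setsymdK A) AC0 setsymd0.
Qed.

Fact cl_mulDl : left_distributive cl_mul +%R.
Proof.
move=> x y z; apply: cl_ext => C; rewrite cl_coefD !cl_mulE -big_split /=.
by apply: eq_bigr => A _; rewrite cl_coefD mulrDl mulrDr.
Qed.

Fact cl_mulDr : right_distributive cl_mul +%R.
Proof.
move=> x y z; apply: cl_ext => C; rewrite cl_coefD !cl_mulE -big_split /=.
by apply: eq_bigr => A _; rewrite cl_coefD mulrDr mulrDr.
Qed.

Fact cl_one_neq0 : cl_one != 0.
Proof.
apply/eqP => /(congr1 (fun x => cl_coef x set0)) /eqP.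
by rewrite cl_mkE cl_coef0 eqxx oner_eq0.
Qed.

HB.instance Definition _ := GRing.Zmodule_isNzRing.Build (clifford K m)
  cl_mulA cl_mul1x cl_mulx1 cl_mulDl cl_mulDr cl_one_neq0.

Lemma cl_coefM x y C : cl_coef (x * y) C =
  \sum_A cl_sign A (setsymd A C) * (cl_coef x A * cl_coef y (setsymd A C)).
Proof. exact: cl_mulE. Qed.

Fact cl_scaleAl (k : K) x y : k *: (x * y) = k *: x * y.
Proof.
apply: cl_ext => C; rewrite cl_coefZ !cl_coefM mulr_sumr.
by apply: eq_bigr => A _; rewrite cl_coefZ; ring.
Qed.

HB.instance Definition _ :=
  GRing.Lmodule_isLalgebra.Build K (clifford K m) cl_scaleAl.

Fact cl_scaleAr (k : K) x y : k *: (x * y) = x * (k *: y).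
Proof.
apply: cl_ext => C; rewrite cl_coefZ !cl_coefM mulr_sumr.
by apply: eq_bigr => A _; rewrite cl_coefZ; ring.
Qed.

HB.instance Definition _ :=
  GRing.Lalgebra_isAlgebra.Build K (clifford K m) cl_scaleAr.

Definition cl_basis A : clifford K m := cl_mk (fun B => (B == A)%:R).

Definition cl_gen (j : 'I_m) : clifford K m := cl_basis [set j].

Definition cl_scalar x : K := cl_coef x set0.

(* The K-linear anti-automorphism with cl_conj e_j = - e_j: it maps e_A to
   e_A^-1, and e_A e_A = cl_sign A A.  This is Clifford conjugation on R_m, the
   only case used below (on C_m one also conjugates the coordinates). *)
Definition cl_conj x : clifford K m :=
  cl_mk (fun A => cl_sign A A * cl_coef x A).

Definition cl_vec (v : 'rV[K]_m) : clifford K m :=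
  \sum_j v 0 j *: cl_gen j.

Lemma cl_basisM A B :
  cl_basis A * cl_basis B = cl_sign A B *: cl_basis (setsymd A B).
Proof.
apply: cl_ext => C; rewrite cl_coefM cl_coefZ (bigD1 A) //= big1 => [|D DA].
  rewrite !cl_mkE eqxx mul1r addr0 -(inj_eq (can_inj (setsymdK A))) setsymdK.
  by case: eqVneq => [->|]; rewrite ?setsymdK // !mulr0.
by rewrite !cl_mkE (negPf DA) mul0r mulr0.
Qed.

Lemma cl_sign11 (i j : 'I_m) :
  cl_sign [set i] [set j] = if (j <= i)%N then -1 else 1.
Proof.
by rewrite /cl_sign big_set1 big_mkcondr big_set1.
Qed.

Lemma cl_gen_sq j : cl_gen j * cl_gen j = -1.
Proof.
rewrite cl_basisM cl_sign11 leqnn setsymdv scaleN1r; congr (- _).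
Qed.

Lemma cl_gen_anticomm i j : i != j ->
  cl_gen i * cl_gen j = - (cl_gen j * cl_gen i).
Proof.
move=> ij; rewrite !cl_basisM !cl_sign11 [setsymd [set j] _]setsymdC.
case: (ltngtP i j) ij => [||/val_inj->] //.
- by rewrite scale1r scaleN1r opprK.
- by rewrite scale1r scaleN1r.
- by rewrite eqxx.
Qed.

Lemma cl_conj_gen j : cl_conj (cl_gen j) = - cl_gen j.
Proof.
apply: cl_ext => A; rewrite cl_coefN !cl_mkE.
by case: eqVneq => [->|]; rewrite ?cl_sign11 ?leqnn ?mulr0 ?oppr0 ?mulN1r.
Qed.

Lemma cl_conjM x y : cl_conj (x * y) = cl_conj y * cl_conj x.
Proof.
apply: cl_ext => C; rewrite cl_mkE !cl_coefM mulr_sumr.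
rewrite (reindex_inj (can_inj (setsymdK C))) /=; apply: eq_bigr => A _.
rewrite !cl_mkE [setsymd (setsymd C A) C]setsymdC setsymdK.
rewrite (setsymdC A C); have : C = setsymd (setsymd C A) A.
  by rewrite -setsymdA setsymdv setsymd0.
move: (setsymd C A) => B {C}->.
rewrite !(cl_signDl, cl_signDr).
have := cl_signV B A; set s := cl_sign B A => ss.
set t := cl_sign A B; set a := cl_sign A A; set b := cl_sign B B.
transitivity (s * s * (t * (a * b) * (cl_coef x B * cl_coef y A))).
  by ring.
by rewrite ss mul1r; ring.
Qed.

End CliffordAlgebra.


From mathcomp Require Import all_classical all_reals all_analysis.
From mathcomp Require Import complex.

Import numFieldNormedType.Exports.

Local Open Scope classical_set_scope.

Lemma sigma_finite_product d1 d2 (T1 : measurableType d1)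
    (T2 : measurableType d2) (R : realType)
    (m1 : {sigma_finite_measure set T1 -> \bar R})
    (m2 : {sigma_finite_measure set T2 -> \bar R}) :
  sigma_finite setT (m1 \x m2)%E.
Proof.
have /sigma_finiteP[F [TF ndF Foo]] := sigma_finiteT m1.
have /sigma_finiteP[G [TG ndG Goo]] := sigma_finiteT m2.
exists (fun n => F n `*` G n).
  rewrite -setXTT TF TG predeqE => -[x y]; split.
    move=> [/= [n _ Fnx] [k _ Gky]]; exists (maxn n k) => //; split.
    - by move: x Fnx; exact/subsetPset/ndF/leq_maxl.
    - by move: y Gky; exact/subsetPset/ndG/leq_maxr.
  by move=> [n _ []/= ? ?]; split; exists n.
move=> k; have [? ?] := Foo k; have [? ?] := Goo k.
split; first exact: measurableX.
by rewrite product_measure1E// lte_mul_pinfty// ge0_fin_numE.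
Qed.

Section LebesgueMeasure.
Context (R : realType).

Local Notation RT := (measurableTypeR R).

Section step.
Context (n : nat) (mu : {sigma_finite_measure set (n.-tuple RT) -> \bar R}).

Definition cons_pair (p : RT * n.-tuple RT) : n.+1.-tuple RT :=
  [tuple of p.1 :: p.2].

Lemma measurable_cons_pair : measurable_fun [set: RT * n.-tuple RT] cons_pair.
Proof. exact: measurable_cons. Qed.

Definition lebesgue_step : set (n.+1.-tuple RT) -> \bar R :=
  pushforward (@lebesgue_measure R \x mu)%E cons_pair.

Let step0 : lebesgue_step set0 = 0%E.
Proof. by rewrite /lebesgue_step /pushforward preimage_set0 measure0. Qed.

Let step_ge0 A : (0 <= lebesgue_step A)%E.
Proof. by rewrite /lebesgue_step /pushforward; exact: measure_ge0. Qed.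

Let step_sigma_additive : semi_sigma_additive lebesgue_step.
Proof.
move=> F mF tF mUF; rewrite /lebesgue_step /pushforward preimage_bigcup.
apply: measure_semi_sigma_additive.
- by move=> k; rewrite -[X in measurable X]setTI; exact: measurable_cons_pair.
- apply/trivIsetP => /= i j _ _ ij; rewrite -preimage_setI.
  by move/trivIsetP : tF => /(_ _ _ _ _ ij) ->//; rewrite preimage_set0.
- rewrite -preimage_bigcup -[X in measurable X]setTI.
  exact: measurable_cons_pair.
Qed.

HB.instance Definition _ := isMeasure.Build _ _ _ lebesgue_step
  step0 step_ge0 step_sigma_additive.

Let step_sigma_finite : sigma_finite [set: n.+1.-tuple RT] lebesgue_step.
Proof.
have [F FT Foo] : sigma_finite setT (@lebesgue_measure R \x mu)%E.
  exact: sigma_finite_product.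
pose uncons (t : n.+1.-tuple RT) : RT * n.-tuple RT :=
  (thead t, [tuple of behead t]).
have consK p : uncons (cons_pair p) = p.
  case: p => a t; rewrite /uncons /cons_pair/=.
  by apply: f_equal2; [exact: theadE|exact/val_inj].
have muncons : measurable_fun [set: n.+1.-tuple RT] uncons.
  apply: measurable_fun_pair; first exact: measurable_tnth.
  exact: measurable_behead.
exists (fun i => uncons @^-1` F i).
  by rewrite -preimage_bigcup -FT preimage_setT.
move=> i; have [mF Fi] := Foo i; split.
  by rewrite -[X in measurable X]setTI; exact: muncons.
rewrite /lebesgue_step /pushforward -comp_preimage.
by rewrite (_ : uncons \o cons_pair = id) //; apply/funext => p; exact: consK.
Qed.

HB.instance Definition _ :=
  Measure_isSigmaFinite.Build _ _ _ lebesgue_step step_sigma_finite.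

End step.

(* Lebesgue measure on R^n, the n-fold product of the measure on R *)
Fixpoint lebesgue_tuple n : {sigma_finite_measure set (n.-tuple RT) -> \bar R} :=
  if n is n'.+1 then lebesgue_step (lebesgue_tuple n') else \d_ [tuple].

End LebesgueMeasure.

Section EuclideanSpace.
Context (R : realType) (m : nat).

Definition dotv (x y : 'rV[R]_m) : R := \sum_j x 0 j * y 0 j.

(* mathcomp-analysis norms 'rV[R]_m by the maximum of the coordinates *)
Definition enorm (x : 'rV[R]_m) : R := Num.sqrt (dotv x x).

Definition eball (r : R) : set 'rV[R]_m := [set x | enorm x <= r].

Definition row_of_tuple (t : m.-tuple (measurableTypeR R)) : 'rV[R]_m :=
  \row_j tnth t j.

Definition Rn_integral (D : set 'rV[R]_m) (f : 'rV[R]_m -> R) : R :=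
  \int[lebesgue_tuple R m]_(t in row_of_tuple @^-1` D) f (row_of_tuple t).

(* Surface integral over S^(m-1), the surface measure of a set being m times
   the volume of the cone over it in the unit ball. *)
Definition sphere_integral (f : 'rV[R]_m -> R) : R :=
  m%:R * Rn_integral (eball 1) (fun x => f ((enorm x)^-1 *: x)).

End EuclideanSpace.

Section DiracOperator.
Context (R : realType) (m : nat).
Implicit Types f : 'rV[R]_m -> clifford R m.

Definition cl_partial (j : 'I_m) f (x : 'rV[R]_m) : clifford R m :=
  cl_mk (fun A => 'D_(delta_mx 0 j) (fun y => cl_coef (f y) A) x).

Definition dirac f (x : 'rV[R]_m) : clifford R m :=
  \sum_j cl_gen R j * cl_partial j f x.

Definition L_op (c : R) f (x : 'rV[R]_m) : clifford R m :=
  dirac (fun y => (1 - enorm y ^+ 2) *: dirac f y) x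
  + (4 * pi ^+ 2 * c ^+ 2 * enorm x ^+ 2) *: f x.

Definition homogeneous_poly (k : nat) f : Prop :=
  exists a : {ffun 'I_m -> 'I_k.+1} -> clifford R m, forall x,
    f x = \sum_(alpha : {ffun 'I_m -> 'I_k.+1} | (\sum_j alpha j == k)%N)
            (\prod_j x 0 j ^+ alpha j) *: a alpha.

(* M_l^+(k), as polynomial functions on R^m *)
Definition left_monogenic (k : nat) : set ('rV[R]_m -> clifford R m) :=
  [set f | homogeneous_poly k f /\ forall x, dirac f x = 0].

Definition monogenic_rank (k : nat) : nat :=
  ((m + k - 2)`! %/ ((m - 2)`! * k`!))%N.

Definition cl_sphere_integral f : clifford R m :=
  cl_mk (fun A => sphere_integral (fun x => cl_coef (f x) A)).

Definition monogenic_basis (k : nat)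
    (Y : 'I_(monogenic_rank k) -> 'rV[R]_m -> clifford R m) : Prop :=
  (forall i, left_monogenic k (Y i)) /\
  (forall f, left_monogenic k f ->
     exists! a : {ffun 'I_(monogenic_rank k) -> clifford R m},
       forall x, f x = \sum_i Y i x * a i).

Definition sphere_orthonormal (k : nat)
    (Y : 'I_(monogenic_rank k) -> 'rV[R]_m -> clifford R m) : Prop :=
  forall i j,
    cl_sphere_integral (fun w => cl_conj (Y i w) * Y j w) = (i == j)%:R.

End DiracOperator.

Section OddCPSWF.
Context (R : realType) (m : nat) (c : R) (Y : 'rV[R]_m -> clifford R m).

Definition smooth (Q : R -> R) : Prop :=
  forall n t, derivable (Q^`(n)) t 1.

Definition odd_function (Q : R -> R) (x : 'rV[R]_m) : clifford R m :=
  cl_vec x * (Q (enorm x ^+ 2) *: Y x).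

(* A function in C^oo([0,1]) is represented by a smooth extension to R; by
   continuity of the derivatives, the equation on the closed ball only depends
   on the restriction to [0,1]. *)
Definition odd_eigenpair (chi : R) (Q : R -> R) : Prop :=
  [/\ smooth Q,
      exists2 t, t \in `[0, 1] & Q t != 0 &
      forall x, eball 1 x ->
        L_op c (odd_function Q) x = chi *: odd_function Q x].

Definition odd_eigenvalues : set R := [set chi | exists Q, odd_eigenpair chi Q].

(* chi is chi_(2N+1), the N-th term (from 0) of the increasing sequence of the
   odd eigenvalues: exactly N of them are smaller. *)
Definition nth_odd_eigenvalue (N : nat) (chi : R) : Prop :=
  odd_eigenvalues chi /\
  ([set chi' | odd_eigenvalues chi' /\ chi' < chi] #= `I_N)%card.

Definition cl_normsq (a : clifford R m) : R := cl_scalar (cl_conj a * a).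

(* psi is psi_(2N+1)^(k,c,i), for Y = Y_k^i; the L^2 normalisation leaves the
   sign of Q free *)
Definition odd_cpswf (N : nat) (psi : 'rV[R]_m -> clifford R m) : Prop :=
  exists chi, exists Q,
    [/\ nth_odd_eigenvalue N chi, odd_eigenpair chi Q,
        forall x, eball 1 x -> psi x = odd_function Q x,
        forall x, ~ eball 1 x -> psi x = 0 &
        Rn_integral (eball 1) (fun x => cl_normsq (psi x)) = 1].

End OddCPSWF.

Section Operators.
Context (R : realType) (m : nat).
Implicit Types f : 'rV[R]_m -> clifford R[i] m.

Local Open Scope complex_scope.

(* e^(i theta) *)
Definition expi (theta : R) : R[i] := cos theta +i* sin theta.

Definition cl_integral (D : set 'rV[R]_m) f : clifford R[i] m :=
  cl_mk (fun A =>
    Rn_integral D (fun x => Re (cl_coef (f x) A)) +i*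
    Rn_integral D (fun x => Im (cl_coef (f x) A))).

Definition space_limit f (x : 'rV[R]_m) : clifford R[i] m :=
  \1_(eball 1) x *: f x.

Definition fourier f (xi : 'rV[R]_m) : clifford R[i] m :=
  cl_integral setT (fun x => expi (- (2 * pi * dotv x xi)) *: f x).

Definition band_limit (c : R) f (x : 'rV[R]_m) : clifford R[i] m :=
  cl_integral (eball c) (fun xi => expi (2 * pi * dotv xi x) *: fourier f xi).

Definition G_op (c : R) f (x : 'rV[R]_m) : clifford R[i] m :=
  \1_(eball 1) x *:
    cl_integral (eball 1) (fun y => expi (2 * pi * c * dotv x y) *: f y).

(* the inclusion of R_m in C_m *)
Definition complexify (f : 'rV[R]_m -> clifford R m) (x : 'rV[R]_m) :
    clifford R[i] m := cl_mk (fun A => (cl_coef (f x) A)%:C).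

End Operators.

(* Main.v *)
Require Import Defs.
From mathcomp Require Import all_boot all_order all_algebra.
From mathcomp Require Import all_classical all_reals all_analysis.
From mathcomp Require Import measurable_realfun complex ring lra.

Set Implicit Arguments.
Unset Strict Implicit.
Unset Printing Implicit Defensive.

Import Order.TTheory GRing.Theory Num.Theory.
Import numFieldNormedType.Exports.

Local Open Scope ring_scope.
Local Open Scope classical_set_scope.

(** Put [a = 2 pi c] and [H = x Y], a harmonic polynomial of degree [l = k + 1] (coordinatewise).
    Let [J] map a function [h] on [0,1] to the function with derivative [h / 2] that vanishes
    at 1.  Integrating by parts over the ball, [h(|y|^2) y_j u] may be replaced by
    [- J h(|y|^2) D_j u]; combined with Euler's identity for [H] this gives Bochner's formula: the
    integral over the ball of [cos(a <x,y> + phi) Q(|y|^2) H(y)] is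
    [a^l H(x) U(x)], where [U(x)] is the integral of
    [cos(a <x,y> + phi - l pi / 2) (J^l Q)(|y|^2)].  The radial equation satisfied by [Q] can be
    integrated [l] times, and the result, integrated by parts against the cosine, says that [U] as
    a function of [|x|] satisfies the same singular differential equation as [Q(|x|^2)].  An energy
    estimate shows that a solution is determined by its value at the origin, so that
    [Q(0) U(x) = U(0) Q(|x|^2)] on the ball.  Thus [psi] is an eigenfunction of the finite Fourier
    transform [G_c], with eigenvalue [mu] say, and rescaling the frequency ball gives
    [Q P_c psi = c^m |mu|^2 psi]. *)

(** That [L_c] commutes with [G_c] would leave open whether the eigenspace is simple. Bochner's
    formula is therefore used before any differential equation: [psi] and its transform both become
    a scalar function of [|x|] times the same [H], and simplicity becomes uniqueness for one scalar
    equation. [H] is harmonic because the Dirac operator squares to minus the Laplacian, sends [x Y]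
    to [-(m + 2k) Y] and kills [Y]. The half in [J] makes the gradient of [J h(|y|^2)] equal to
    [h(|y|^2) y]; the value 0 at 1 removes the boundary terms, so no surface integral occurs. The
    phase [phi] carries real and imaginary parts together, and the shift by [l pi / 2] is the real
    form of a factor [(-i)^l]. The radial equation is singular at 0 and at 1. At 1 this helps: its
    flux has a factor [1 - |x|^2], so repeated integration from 1 produces no constants. At 0 the
    functions compared are smooth in [|x|^2], which excludes the singular solution and leaves one
    free constant. Applied to [Q] itself, uniqueness also gives that [Q(0)] is not 0, without which
    the proportionality would be empty. *)

(** * Lebesgue measure under dilations and translations *)

Section AffineMaps.
Context (R : realType).
Local Notation RT := (measurableTypeR R).

(** Multiplied by [r], the pulled-back measure gives each half-open interval its length, and
    Lebesgue measure is the only measure that does so. *)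
Lemma lebesgue_measure_affine (r v : R) (A : set RT) : 0 < r -> measurable A ->
  @lebesgue_measure R ((fun x => r * x + v) @^-1` A)
    = (r^-1%:E * @lebesgue_measure R A)%E.
Proof.
move=> r0 mA.
have r0' : 0 <= r by exact: ltW.
have mf : measurable_fun setT (fun x : RT => r * x + v : RT).
  by apply: measurable_funD => //; exact: measurable_funM.
pose nu := mscale (NngNum r0') (pushforward (@lebesgue_measure R)
  (fun x : RT => r * x + v : RT)).
have nuE X : nu mf X =
    (r%:E * @lebesgue_measure R ((fun x => (r * x + v)%R) @^-1` X))%E by [].
have -> : @lebesgue_measure R A = nu mf A.
  apply: lebesgue_measure_unique => // X [[a b]] _ <-.
  rewrite [RHS]nuE /= (_ : _ @^-1` _ = `](a - v) / r, (b - v) / r]); last first.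
    by apply/seteqP; split=> x /=; rewrite !in_itv /=
      ltr_pdivrMr// ler_pdivlMr// ltrBlDr lerBrDr [x * r]mulrC.
  rewrite !lebesgue_measure_itv /= !lte_fin ltr_pM2r ?invr_gt0// ltrD2r.
  case: ifPn => _; last by rewrite mule0.
  rewrite -!EFinD -EFinM; congr EFin; field.
  by rewrite gt_eqF.
by rewrite nuE muleA -EFinM mulVf ?gt_eqF// mul1e.
Qed.

(** The translation is indexed by [nat] rather than by ['I_n], so that dropping the first coordinate
    simply replaces [v] by [v \o S] in inductions on [n]. *)
Definition tuple_affine n (r : R) (v : nat -> R) (t : n.-tuple RT) :
  n.-tuple RT := [tuple r * tnth t i + v i | i < n].

Lemma measurable_tuple_affine n r v :
  measurable_fun [set: n.-tuple RT] (@tuple_affine n r v).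
Proof.
apply/measurable_fun_tnthP => i.
rewrite (_ : _ \o _ = fun t => r * tnth t i + v i); last first.
  by apply/funext => t /=; rewrite tnth_mktuple.
by apply: measurable_funD => //; apply: measurable_funM => //;
  exact: measurable_tnth.
Qed.

Lemma tuple_affine_cons n r v (p : RT * n.-tuple RT) :
  tuple_affine r v (cons_pair p)
    = cons_pair (r * p.1 + v 0%N, tuple_affine r (v \o S) p.2).
Proof.
apply: eq_from_tnth => i; rewrite tnth_mktuple /cons_pair.
have [j ->|->] := fintype.unliftP ord0 i; last by rewrite !(tnth_nth 0).
by rewrite !tnthS tnth_mktuple.
Qed.

(** A product measure is determined by its values on rectangles; there the rescaled pull-back splits
    into the one-dimensional case and the induction hypothesis. *)
Lemma lebesgue_tuple_affine n (r : R) (v : nat -> R) (A : set (n.-tuple RT)) :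
  0 < r -> measurable A ->
  lebesgue_tuple R n (tuple_affine r v @^-1` A)
    = ((r ^- n)%:E * lebesgue_tuple R n A)%E.
Proof.
move=> r0; elim: n v A => [|n IH] v A mA.
  rewrite expr0 invr1 mul1e /= /dirac/=; congr (_%:E); rewrite !indicE.
  have -> : tuple_affine r v @^-1` A = A; last by [].
  apply/seteqP; split=> x /=;
    by rewrite (_ : tuple_affine r v x = x) //; apply: eq_from_tnth => -[].
have r0' : 0 <= r ^+ n.+1 by rewrite exprn_ge0// ltW.
pose Phi (p : RT * n.-tuple RT) : RT * n.-tuple RT :=
  (r * p.1 + v 0%N, tuple_affine r (v \o S) p.2).
have mf : measurable_fun setT (fun x : RT => r * x + v 0%N : RT).
  by apply: measurable_funD => //; exact: measurable_funM.
have mPhi : measurable_fun setT Phi.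
  apply: measurable_fun_pair.
    by apply: (measurableT_comp mf).
  by apply: (measurableT_comp (measurable_tuple_affine _ _)).
pose nu := mscale (NngNum r0')
  (pushforward (@lebesgue_measure R \x lebesgue_tuple R n)%E Phi).
have nuE X : nu mPhi X = ((r ^+ n.+1)%:E *
    (@lebesgue_measure R \x lebesgue_tuple R n) (Phi @^-1` X))%E by [].
rewrite /= /lebesgue_step /pushforward.
have mB : measurable (@cons_pair R n @^-1` A).
  by rewrite -[X in measurable X]setTI; exact: measurable_cons_pair.
set B := (X in ((r ^- n.+1)%:E * (_ \x _) X)%E).
have -> : (@lebesgue_measure R \x lebesgue_tuple R n)%E B = nu mPhi B.
  apply: product_measure_unique => // A1 A2 mA1 mA2.
  rewrite [LHS]nuE (_ : Phi @^-1` _ = ((fun x : RT => r * x + v 0%N : RT) @^-1` A1)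
     `*` (tuple_affine r (v \o S) @^-1` A2))//.
  rewrite product_measure1E//; last 2 first.
  - by rewrite -[X in measurable X]setTI; exact: mf.
  - by rewrite -[X in measurable X]setTI; exact: measurable_tuple_affine.
  transitivity ((r ^+ n.+1)%:E * ((r^-1%:E * @lebesgue_measure R A1) *
      ((r ^- n)%:E * lebesgue_tuple R n A2)))%E.
    by congr (_ * (_ * _))%E; [exact: lebesgue_measure_affine|exact: IH].
  rewrite muleACA -EFinM (muleA (r ^+ n.+1)%:E) -EFinM.
  by rewrite -invfM -exprS mulfV ?mul1e// expf_neq0// gt_eqF.
rewrite nuE muleA -EFinM mulVf ?mul1e; last first.
  by rewrite expf_neq0// gt_eqF.
congr (_ _).
by apply/seteqP; split=> p /=; rewrite tuple_affine_cons.
Qed.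

End AffineMaps.

(** * Change of variables, volumes of balls, and the sphere as a null set *)

Section RowIntegrals.
Context (R : realType) (m : nat).
Local Notation RT := (measurableTypeR R).
Local Notation mu := (lebesgue_tuple R m).
Local Notation rt := (@row_of_tuple R m).
Implicit Types f g u : 'rV[R]_m -> R.

(** The scaling law says that [mu] is [r ^+ m] times its own image under the affine map. *)
Lemma ge0_integral_affine (r : R) (v : nat -> R) (f : m.-tuple RT -> \bar R) :
  0 < r -> measurable_fun setT f -> (forall t, (0 <= f t)%E) ->
  (\int[mu]_t f t = (r ^+ m)%:E * \int[mu]_t f (tuple_affine r v t))%E.
Proof.
move=> r0 mf f0.
have r0' : 0 <= r ^+ m by rewrite exprn_ge0// ltW.
rewrite (eq_measure_integral (mscale (NngNum r0')
  (pushforward mu (tuple_affine r v)))).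
- exact: measurable_tuple_affine.
- move=> mphi; rewrite ge0_integral_mscale//= ge0_integral_pushforward//.
- move=> mphi A mA _ /=; rewrite /mscale /= /pushforward.
  rewrite (lebesgue_tuple_affine v r0 mA) muleA -EFinM divff ?mul1e//.
  by rewrite expf_neq0// gt_eqF.
Qed.

Lemma integrable_affine (r : R) (v : nat -> R) (f : m.-tuple RT -> R) :
  0 < r -> mu.-integrable setT (EFin \o f) ->
  mu.-integrable setT (EFin \o (f \o tuple_affine r v)).
Proof.
move=> r0 fi.
have r0' : 0 <= r ^+ m by rewrite exprn_ge0// ltW.
have mf : measurable_fun setT (EFin \o f) by case/integrableP: fi.
have mphi := @measurable_tuple_affine R m r v.
apply/integrableP; split; first exact: (measurableT_comp mf).
case/integrableP: fi => _; rewrite (ge0_integral_affine v r0) //; last first.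
  exact: measurableT_comp.
set I := (X in (_ * X < _)%E -> _) => Ioo; rewrite -/I.
have -> : I = ((r ^- m)%:E * ((r ^+ m)%:E * I))%E.
  by rewrite muleA -EFinM mulVf ?mul1e// expf_neq0// gt_eqF.
by rewrite lte_mul_pinfty// lee_fin invr_ge0.
Qed.

Lemma integral_affine (r : R) (v : nat -> R) (f : m.-tuple RT -> R) :
  0 < r -> mu.-integrable setT (EFin \o f) ->
  \int[mu]_t f t = r ^+ m * \int[mu]_t f (tuple_affine r v t).
Proof.
move=> r0 fi; have fphi := integrable_affine v r0 fi.
have mf : measurable_fun setT (EFin \o f) by case/integrableP: fi.
rewrite /Rintegral -[RHS]/(fine (r ^+ m)%:E * _) -fineM//; last first.
  exact: integrable_fin_num fphi.
congr fine; rewrite [LHS]integralE [in RHS]integralE muleBr//; last first.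
  apply: fin_num_adde_defr.
  exact: (integrable_pos_fin_num measurableT fphi).
congr (_ - _)%E.
  have H := @ge0_integral_affine r v (EFin \o f)^\+%E r0.
  rewrite [LHS]H //; last exact: measurable_funepos.
  by congr (_ * _)%E; apply: eq_integral => t _; rewrite !funeposE.
have H := @ge0_integral_affine r v (EFin \o f)^\-%E r0.
rewrite [LHS]H //; last exact: measurable_funeneg.
by congr (_ * _)%E; apply: eq_integral => t _; rewrite !funenegE.
Qed.

Lemma measurable_coord (j : 'I_m) : measurable_fun setT (fun t => rt t 0 j).
Proof.
rewrite (_ : (fun _ => _) = (fun t : m.-tuple RT => tnth t j)); first exact: measurable_tnth.
by apply/funext => t; rewrite mxE.
Qed.

Lemma measurable_sqnorm_row : measurable_fun setT (fun t => dotv (rt t) (rt t)).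
Proof.
by apply: measurable_sum => j; apply: measurable_funM; exact: measurable_coord.
Qed.

Lemma dotvv_ge0 (x : 'rV[R]_m) : 0 <= dotv x x.
Proof. by apply: sumr_ge0 => j _; rewrite -expr2 sqr_ge0. Qed.

Lemma sqr_enorm (x : 'rV[R]_m) : enorm x ^+ 2 = dotv x x.
Proof. by rewrite sqr_sqrtr// dotvv_ge0. Qed.

Lemma eballE (r : R) (x : 'rV[R]_m) : 0 <= r -> eball r x <-> dotv x x <= r ^+ 2.
Proof.
move=> r0; rewrite /eball /= -sqr_enorm ler_pXn2r// nnegrE//.
exact: sqrtr_ge0.
Qed.

Lemma dotvZ (a : R) (x y : 'rV[R]_m) : dotv (a *: x) y = a * dotv x y.
Proof.
by rewrite /dotv mulr_sumr; apply: eq_bigr => j _; rewrite mxE mulrA.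
Qed.

Lemma dotvC (x y : 'rV[R]_m) : dotv x y = dotv y x.
Proof. by apply: eq_bigr => j _; rewrite mulrC. Qed.

Lemma dotvD (x y z : 'rV[R]_m) : dotv (x + y) z = dotv x z + dotv y z.
Proof.
by rewrite /dotv -big_split; apply: eq_bigr => j _; rewrite mxE mulrDl.
Qed.

Lemma dotv_delta (x : 'rV[R]_m) j : dotv x (delta_mx 0 j) = x 0 j.
Proof.
rewrite /dotv (bigD1 j)//= mxE !eqxx mulr1 big1 ?addr0// => i ij.
by rewrite mxE (negPf ij) andbF mulr0.
Qed.

Lemma coord_le_dotv (x : 'rV[R]_m) j : x 0 j ^+ 2 <= dotv x x.
Proof.
rewrite /dotv (bigD1 j)//= -expr2 lerDl sumr_ge0// => i _.
by rewrite -expr2 sqr_ge0.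
Qed.

Lemma measurable_eball (r : R) : 0 <= r -> measurable (rt @^-1` eball r).
Proof.
move=> r0; rewrite (_ : _ @^-1` _ =
  (fun t => dotv (rt t) (rt t)) @^-1` `]-oo, r ^+ 2]%classic).
  by rewrite -[X in measurable X]setTI; apply: measurable_sqnorm_row.
by apply/seteqP; split=> t; rewrite /preimage /= in_itv/= -eballE.
Qed.

Definition cube n (r : R) : set (n.-tuple RT) :=
  [set t | forall i, `|tnth t i| <= r].

Lemma measurable_cube n (r : R) : measurable (@cube n r).
Proof.
rewrite (_ : @cube n r = \bigcap_(i : 'I_n)
    ((fun t : n.-tuple RT => tnth t i) @^-1` `[- r, r]%classic)).
  apply: fin_bigcap_measurable => // i _.
  by rewrite -[X in measurable X]setTI; apply: measurable_tnth.
apply/seteqP; split=> t; rewrite /cube /bigcap /=.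
  by move=> H i _ /=; rewrite in_itv/= -ler_norml.
by move=> H i; have := H i Logic.I; rewrite /= in_itv/= -ler_norml.
Qed.

(** Cubes, unlike balls, are products along the recursion defining [lebesgue_tuple]; they serve to
    show that balls have finite volume. *)
Lemma lebesgue_cube_lty n (r : R) : 0 <= r ->
  (lebesgue_tuple R n (@cube n r) < +oo)%E.
Proof.
move=> r0; elim: n => [|n IH].
  by rewrite /= /dirac /= indicE ltry.
rewrite /= /lebesgue_step /pushforward.
rewrite (_ : _ @^-1` _ = `[- r, r]%classic `*` @cube n r).
  rewrite product_measure1E//=; last exact: measurable_cube.
  rewrite lebesgue_measure_itv/= lte_fin.
  case: ifPn => _; last by rewrite mul0e.
  by rewrite -EFinD lte_mul_pinfty// lee_fin opprK addr_ge0.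
apply/seteqP; split=> -[x t]; rewrite /cube /preimage /=.
  move=> H; split=> /=.
    by rewrite in_itv/= -ler_norml; have := H ord0; rewrite (tnth_nth 0).
  by move=> i; have := H (lift ord0 i); rewrite tnthS.
move=> [/= + H] i; rewrite in_itv/= -ler_norml => xr.
have [j ->|->] := fintype.unliftP ord0 i; last by rewrite (tnth_nth 0).
by rewrite tnthS.
Qed.

Lemma eball_lty (r : R) : 0 <= r -> (mu (rt @^-1` eball r) < +oo)%E.
Proof.
move=> r0; apply: le_lt_trans (lebesgue_cube_lty m r0).
apply: le_measure; rewrite ?inE.
- exact: measurable_eball.
- exact: measurable_cube.
move=> t; rewrite /preimage /= eballE// => H i.
rewrite -(@ler_pXn2r _ 2)// ?nnegrE// real_normK ?num_real//.
have := coord_le_dotv (rt t) i; rewrite mxE => /le_trans; exact.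
Qed.

Lemma row_of_tuple_affine (r : R) (v : nat -> R) t :
  rt (tuple_affine r v t) = r *: rt t + \row_j v j.
Proof. by apply/rowP => j; rewrite !mxE tnth_mktuple. Qed.

Lemma row_of_tuple_scale (r : R) t :
  rt (tuple_affine r (fun=> 0) t) = r *: rt t.
Proof.
rewrite row_of_tuple_affine (_ : \row__ _ = 0) ?addr0//.
by apply/rowP => j; rewrite !mxE.
Qed.

Lemma eballZ (a r : R) (x : 'rV[R]_m) : 0 < a -> 0 <= r ->
  eball (a * r) (a *: x) <-> eball r x.
Proof.
move=> a0 r0; have ar0 : 0 <= a * r by rewrite mulr_ge0// ltW.
rewrite (eballE _ ar0) (eballE _ r0) dotvZ dotvC dotvZ exprMn.
by rewrite mulrA -expr2 ler_pM2l// exprn_gt0.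
Qed.

Lemma eball_scale (r : R) : 0 < r ->
  mu (rt @^-1` eball 1) = ((r ^- m)%:E * mu (rt @^-1` eball r))%E.
Proof.
move=> r0; rewrite -(lebesgue_tuple_affine (fun=> 0) r0); last first.
  exact: (measurable_eball (ltW r0)).
congr (mu _); apply/seteqP; split=> t; rewrite /preimage /=
  row_of_tuple_scale -[X in eball X (_ *: _)]mulr1 => /eballZ; exact.
Qed.

(* The unit sphere lies in the shells between B(r) and B(1), whose volumes tend to 0. *)
Lemma sphere_null : mu [set t | dotv (rt t) (rt t) = 1] = 0%E.
Proof.
set S := [set t | _].
have mS : measurable S.
  rewrite (_ : S = (fun t => dotv (rt t) (rt t)) @^-1` [set 1])//.
  by rewrite -[X in measurable X]setTI; apply: measurable_sqnorm_row.
have mB := measurable_eball (@ler01 R).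
have Boo := eball_lty (@ler01 R).
have Bfin : mu (rt @^-1` eball 1) \is a fin_num by rewrite ge0_fin_numE.
have shell (e : R) : 0 < e < 1 ->
    (mu S <= (m%:R * e * fine (mu (rt @^-1` eball 1)))%:E)%E.
  move=> /andP[e0 e1].
  have r0 : 0 < 1 - e by rewrite subr_gt0.
  have mBr := measurable_eball (ltW r0).
  have Br : mu (rt @^-1` eball (1 - e)) =
      (((1 - e) ^+ m)%:E * mu (rt @^-1` eball 1))%E.
    rewrite (eball_scale r0) muleA -EFinM divff ?mul1e//.
    by rewrite expf_neq0// gt_eqF.
  have bern : 1 - m%:R * e <= (1 - e) ^+ m.
    elim: m => [|n IH]; first by rewrite mul0r subr0 expr0.
    rewrite exprS; apply: le_trans (ler_wpM2l (ltW r0) IH).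
    rewrite -subr_ge0 (_ : _ - _ = n%:R * e * e); last by rewrite -natr1; ring.
    by rewrite !mulr_ge0// ltW.
  have SB : (mu S + mu (rt @^-1` eball (1 - e)) <= mu (rt @^-1` eball 1))%E.
    rewrite -measureU//.
      apply: le_measure; rewrite ?inE//; first exact: measurableU.
      move=> t [|]; rewrite /S /preimage /= !eballE//; try exact: ltW.
        by move=> ->; rewrite expr1n.
      by move=> /le_trans; apply; rewrite ler_pXn2r ?nnegrE ?(ltW r0)// gerBl ltW.
    apply/seteqP; split=> // t []; rewrite /S /preimage /= eballE ?(ltW r0)//.
    by move=> ->; rewrite leNgt exprn_ilt1// ?(ltW r0)// gtrBl.
  have Sfin : mu S \is a fin_num.
    by rewrite ge0_fin_numE//; apply: le_lt_trans Boo; apply: le_trans SB; rewrite leeDl.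
  move: SB; rewrite Br -(fineK Bfin) -(fineK Sfin) -EFinM -EFinD !lee_fin.
  set V := fine (mu (rt @^-1` _)); move=> SB.
  have V0 : 0 <= V by rewrite fine_ge0.
  rewrite -lerBrDr in SB; apply: le_trans SB _.
  rewrite -{1}[V]mul1r -mulrBl ler_wpM2r// lerBlDr -lerBlDl//.
apply/eqP; rewrite eq_le measure_ge0 andbT; apply/lee_addgt0Pr => e e0.
rewrite add0e; set V := fine (mu (rt @^-1` eball 1)) in shell.
have V0 : 0 <= V by rewrite fine_ge0.
have w0 : 0 <= m%:R * V by rewrite mulr_ge0.
have d0 : 0 < m%:R * V + 1 + e by rewrite addr_gt0// ltr_wpDl.
(* This denominator keeps the thickness strictly between 0 and 1 and exceeds [m V], so the bound on
   the shell is at most [e]. *)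
apply: (le_trans (shell (e / (m%:R * V + 1 + e)) _)).
  by rewrite divr_gt0//= ltr_pdivrMr// mul1r ltrDr ltr_wpDl.
rewrite lee_fin mulrAC mulrA ler_pdivrMr// mulrC ler_wpM2l ?(ltW e0)//.
by rewrite -addrA lerDl addr_ge0// ltW.
Qed.

End RowIntegrals.

(** * Directional derivatives through restriction to lines *)

Section DirectionalDerivatives.
Context (R : realType) (V : normedModType R).
Implicit Types (f g : V -> R) (x v : V).

(** Restricting to a line turns a directional derivative into a one-variable one, so that the
    one-variable chain rule applies without Fréchet differentiability. *)
Lemma is_derive_line f x v (t d : R) :
  is_derive (x + t *: v) v f d <->
  is_derive t 1 (fun s : R => f (x + s *: v)) d.
Proof.
have E : (fun h : R => h^-1 *: ((f \o shift (x + t *: v)) (h *: v) - f (x + t *: v)))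
    = (fun h : R => h^-1 *: (((fun s : R => f (x + s *: v)) \o shift t) (h *: (1 : R))
        - f (x + t *: v))).
  apply/funext => h /=; congr (_ *: (f _ - _)).
  by rewrite scalerDl addrCA [h%:A]mulr1.
split=> -[df dv]; split.
- by rewrite /derivable -E.
- by rewrite -dv /derive -E.
- by rewrite /derivable E.
- by rewrite -dv /derive E.
Qed.

Lemma is_derive_line0 f x v (d : R) :
  is_derive x v f d <-> is_derive (0 : R) 1 (fun s : R => f (x + s *: v)) d.
Proof. by rewrite -is_derive_line scale0r addr0. Qed.

Lemma is_derive_comp1 (phi : R -> R) f x v (a d : R) :
  is_derive (f x) 1 phi a -> is_derive x v f d ->
  is_derive x v (phi \o f) (a * d).
Proof.
move=> dphi /is_derive_line0 df; apply/is_derive_line0.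
by apply: (is_derive1_comp (g := fun s : R => f (x + s *: v))) df;
  rewrite scale0r addr0.
Qed.

Lemma is_derive_mul f g x v (a b : R) :
  is_derive x v f a -> is_derive x v g b ->
  is_derive x v (fun y => f y * g y) (f x * b + g x * a).
Proof. by move=> df dg; exact: is_deriveM. Qed.

Lemma is_derive_add f g x v (a b : R) :
  is_derive x v f a -> is_derive x v g b ->
  is_derive x v (fun y => f y + g y) (a + b).
Proof. by move=> df dg; exact: is_deriveD. Qed.

Lemma is_derive_bigsum (I : Type) (s : seq I) (P : pred I) (f : I -> V -> R)
    (d : I -> R) x v :
  (forall i, is_derive x v (f i) (d i)) ->
  is_derive x v (fun y => \sum_(i <- s | P i) f i y) (\sum_(i <- s | P i) d i).
Proof.
move=> df; elim: s => [|i s IH].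
  rewrite big_nil; under eq_fun do rewrite big_nil.
  exact: is_derive_cst.
rewrite big_cons; under eq_fun do rewrite big_cons.
by case: (P i) => //; exact: is_derive_add.
Qed.

(** Dominated convergence will be applied to a sequence of difference quotients, hence the steps
    [1 / (n + 1)]. *)
Lemma is_derive_seq f x v (d : R) : is_derive x v f d ->
  ((f (x + n.+1%:R^-1 *: v) - f x) / n.+1%:R^-1 : R) @[n --> \oo] --> d.
Proof.
move=> [/cvg_ex[/= l fl] dv].
have <- : l = d by rewrite -dv; apply/esym/cvg_lim.
have /cvgr_dnbhsP/(_ (fun n : nat => n.+1%:R^-1)) H := fl.
have -> : (fun n : nat => (f (x + n.+1%:R^-1 *: v) - f x) / n.+1%:R^-1) =
    (fun n : nat => (n.+1%:R^-1)^-1 *: (f (n.+1%:R^-1 *: v + x) - f x)).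
  by apply/funext => n; rewrite [x + _]addrC [LHS]mulrC.
by apply: H; split=> [n|]; [rewrite invr_neq0|exact: cvg_harmonic].
Qed.

End DirectionalDerivatives.

(** * A class of functions integrable over every ball *)

Section LocallyBounded.
Context (R : realType) (m : nat).
Local Notation mu := (lebesgue_tuple R m).
Local Notation rt := (@row_of_tuple R m).
Implicit Types f g u : 'rV[R]_m -> R.

(* Measurable and bounded on bounded sets: integrable on every ball. *)
Definition lbm f := measurable_fun setT (f \o rt) /\
  forall r : R, exists M, forall x, enorm x <= r -> `|f x| <= M.

Lemma enorm_ge0 (x : 'rV[R]_m) : 0 <= enorm x.
Proof. exact: sqrtr_ge0. Qed.

Lemma lbm_cst a : lbm (fun=> a).
Proof. by split; [exact: measurable_cst|move=> r; exists `|a|]. Qed.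

Lemma lbm_coord j : lbm (fun x => x 0 j).
Proof.
split; first exact: measurable_coord.
move=> r; exists r => x xr.
apply: le_trans xr; rewrite -(@ler_pXn2r _ 2)// ?nnegrE ?enorm_ge0//.
by rewrite real_normK ?num_real// sqr_enorm coord_le_dotv.
Qed.

Lemma lbmD f g : lbm f -> lbm g -> lbm (fun x => f x + g x).
Proof.
move=> [mf bf] [mg bg]; split; first exact: measurable_funD mf mg.
move=> r; have [M1 H1] := bf r; have [M2 H2] := bg r.
exists (M1 + M2) => x xr.
by apply: le_trans (ler_normD _ _) _; apply: lerD; [exact: H1|exact: H2].
Qed.

Lemma lbmM f g : lbm f -> lbm g -> lbm (fun x => f x * g x).
Proof.
move=> [mf bf] [mg bg]; split; first exact: measurable_funM mf mg.
move=> r; have [M1 H1] := bf r; have [M2 H2] := bg r.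
exists (M1 * M2) => x xr.
by rewrite normrM; apply: ler_pM => //; [exact: H1|exact: H2].
Qed.

Lemma lbmN f : lbm f -> lbm (fun x => - f x).
Proof.
move=> nf; rewrite (_ : (fun x => _) = (fun x => -1 * f x)).
  by apply: lbmM => //; exact: lbm_cst.
by apply/funext => x; rewrite mulN1r.
Qed.

Lemma lbm_sum (I : Type) (s : seq I) (P : pred I) (f : I -> 'rV[R]_m -> R) :
  (forall i, lbm (f i)) -> lbm (fun x => \sum_(i <- s | P i) f i x).
Proof.
move=> nf; elim: s => [|i s IH].
  by under eq_fun do rewrite big_nil; exact: lbm_cst.
under eq_fun do rewrite big_cons.
by case: (P i) => //; exact: lbmD.
Qed.

Lemma continuous_bounded_on (phi : R -> R) (a b : R) : continuous phi ->
  exists M, forall s, a <= s <= b -> `|phi s| <= M.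
Proof.
move=> cphi; have [ab|ba] := leP a b; last first.
  by exists 0 => s /andP[/le_trans/[apply]]; rewrite leNgt ba.
have [|c _ H] := @EVT_max R (fun s => `|phi s|) a b ab.
  apply: continuous_subspaceT => x.
  by apply: continuous_comp; [exact: cphi|exact: norm_continuous].
by exists `|phi c| => s sab; apply: H; rewrite in_itv.
Qed.

Lemma lbm_comp (phi : R -> R) f : continuous phi -> lbm f -> lbm (phi \o f).
Proof.
move=> cphi [mf bf]; split.
  rewrite -compA; apply: measurableT_comp mf.
  exact: continuous_measurable_fun.
move=> r; have [M H] := bf r.
have [M' H'] := continuous_bounded_on (- M) M cphi.
by exists M' => x xr; apply: H'; rewrite -ler_norml; exact: H.
Qed.

Lemma lbm_dotv x : lbm (dotv x).
Proof. by apply: lbm_sum => j; apply: lbmM; [exact: lbm_cst|exact: lbm_coord]. Qed.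

Lemma lbm_sqnorm : lbm (fun y => dotv y y).
Proof. by apply: lbm_sum => j; apply: lbmM; exact: lbm_coord. Qed.

Lemma lbm_cos x phi : lbm (fun y => cos (dotv x y + phi)).
Proof.
apply: (@lbm_comp cos (fun y => dotv x y + phi)).
  exact: continuous_cos.
by apply: lbmD; [exact: lbm_dotv|exact: lbm_cst].
Qed.

Lemma lbm_integrable r f : 0 <= r -> lbm f ->
  mu.-integrable (rt @^-1` eball r) (EFin \o (f \o rt)).
Proof.
move=> r0 [mf bf]; apply: measurable_bounded_integrable.
- exact: measurable_eball.
- exact: eball_lty.
- exact: measurable_funTS.
- have [M H] := bf r; exists M; split; first exact: num_real.
  move=> K MK t; rewrite /preimage /= => /H /le_trans; apply; exact: ltW.
Qed.

Lemma is_derive_coord (y v : 'rV[R]_m) i :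
  is_derive y v (fun x => x 0 i) (v 0 i).
Proof.
apply/is_derive_line0.
rewrite (_ : (fun _ => _) = (fun s : R => y 0 i + s * v 0 i)); last first.
  by apply/funext => s; rewrite !mxE.
by apply: is_derive_eq; rewrite /GRing.scale /=; ring.
Qed.

Lemma is_derive_dotv (x y v : 'rV[R]_m) : is_derive y v (dotv x) (dotv x v).
Proof.
apply: is_derive_bigsum => i; rewrite -[x 0 i * v 0 i]addr0.
rewrite -[X in _ + X](mulr0 (y 0 i)).
by apply: is_derive_mul; exact: is_derive_coord.
Qed.

Lemma is_derive_sqnorm (y v : 'rV[R]_m) :
  is_derive y v (fun x => dotv x x) (2 * dotv y v).
Proof.
rewrite /dotv mulr_sumr; apply: is_derive_bigsum => i.
rewrite mulr2n mulrDl !mul1r.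
by apply: is_derive_mul; exact: is_derive_coord.
Qed.

End LocallyBounded.

(** * Integration by parts over the unit ball *)

Section BallIntegrationByParts.
Context (R : realType) (m : nat).
Local Notation mu := (lebesgue_tuple R m).
Local Notation rt := (@row_of_tuple R m).
Implicit Types f g u : 'rV[R]_m -> R.

Lemma lipschitz_of_derive (f df : R -> R) (a b L : R) :
  (forall s, a <= s <= b -> is_derive s 1 f (df s)) ->
  (forall s, a <= s <= b -> `|df s| <= L) ->
  forall s s', a <= s <= b -> a <= s' <= b -> `|f s' - f s| <= L * `|s' - s|.
Proof.
move=> df1 dfL.
suff H s s' : a <= s <= b -> a <= s' <= b -> s <= s' ->
    `|f s' - f s| <= L * `|s' - s|.
  move=> s s' sab s'ab; have [|/ltW] := leP s s'; first exact: H.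
  by move=> ss; rewrite distrC [`|s' - s|]distrC; exact: H.
move=> /andP[as_ sb] /andP[as' s'b] ss'.
have [||c css' ->] := @MVT_segment R f df s s' ss'.
- move=> x; rewrite in_itv/= => /andP[sx xs']; apply: df1.
  by rewrite (le_trans as_ (ltW sx)) (le_trans (ltW xs') s'b).
- apply: derivable_within_continuous => x; rewrite in_itv/= => /andP[sx xs'].
  have [] // := df1 x; by rewrite (le_trans as_ sx) (le_trans xs' s'b).
move: css'; rewrite in_itv/= => /andP[sc cs'].
rewrite normrM ler_wpM2r//; apply: dfL.
by rewrite (le_trans as_ sc) (le_trans cs' s'b).
Qed.

Context (h J : R -> R) (ch : continuous h) (cJ : continuous J).
Context (dJ : forall s : R, 0 <= s <= 1 -> is_derive s 1 J (h s / 2)).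
Context (J1 : J 1 = 0).
Context (j : 'I_m) (u du : 'rV[R]_m -> R).
Context (lu : lbm u) (ldu : lbm du).
Context (deru : forall y, is_derive y (delta_mx 0 j) u (du y)).

Local Notation e_ := (delta_mx 0 j : 'rV[R]_m).

(* [min(s, 1)].  Since [J 1 = 0], composing with it extends the integrand by 0 outside the ball
   without a jump, so that translation invariance applies to its difference quotients. *)
Let mn (s : R) : R := (s + 1 - `|s - 1|) / 2.

Let mn_le s : s <= 1 -> mn s = s.
Proof.
move=> s1; by rewrite /mn ler0_norm ?subr_le0//; field.
Qed.

Let mn_ge s : 1 <= s -> mn s = 1.
Proof.
move=> s1; by rewrite /mn ger0_norm ?subr_ge0//; field.
Qed.

Let mn01 s : 0 <= s -> 0 <= mn s <= 1.
Proof.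
move=> s0; have [s1|/ltW s1] := leP s 1; first by rewrite mn_le// s0.
by rewrite mn_ge// ler01 lexx.
Qed.

Let mn_lip s s' : `|mn s' - mn s| <= `|s' - s|.
Proof.
have -> : mn s' - mn s = (s' - s - (`|s' - 1| - `|s - 1|)) / 2.
  by rewrite /mn; field.
rewrite normrM [`|2^-1|]ger0_norm// ler_pdivrMr//.
apply: le_trans (ler_normB _ _) _.
rewrite mulrDr mulr1 lerD2l.
apply: le_trans (ler_dist_dist _ _) _.
by rewrite (_ : s' - 1 - (s - 1) = s' - s)//; ring.
Qed.

Let Fu (y : 'rV[R]_m) : R := J (mn (dotv y y)) * u y.

Let lFu : lbm Fu.
Proof.
apply: lbmM => //.
apply: (@lbm_comp _ _ (J \o mn) (fun y => dotv y y)); last exact: lbm_sqnorm.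
move=> s; apply: continuous_comp; last exact: cJ.
apply: continuousM; last exact: cvg_cst.
apply: continuousB.
  by apply: continuousD; [exact: cvg_id|exact: cvg_cst].
apply: continuous_comp; last exact: norm_continuous.
by apply: continuousB; [exact: cvg_id|exact: cvg_cst].
Qed.

Let Fu_out y : 1 <= dotv y y -> Fu y = 0.
Proof. by move=> y1; rewrite /Fu mn_ge// J1 mul0r. Qed.

(** Inside the ball this is the derivative of [Fu] along [e_]: the factor 2 from differentiating
    [|y|^2] cancels the half in [dJ]. *)
Let dFu (y : 'rV[R]_m) : R :=
  h (dotv y y) * y 0 j * u y + J (dotv y y) * du y.

Let sqnorm_line y (t : R) :
  dotv (y + t *: e_) (y + t *: e_) = dotv y y + (2 * t * y 0 j + t * t).
Proof.
have dr (x w z : 'rV[R]_m) : dotv x (w + z) = dotv x w + dotv x z.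
  by rewrite dotvC dotvD !(dotvC x).
have dZ (a : R) (x w : 'rV[R]_m) : dotv x (a *: w) = a * dotv x w.
  by rewrite dotvC dotvZ dotvC.
rewrite dr !dotvD dZ dZ !dotvZ [dotv e_ y]dotvC !dotv_delta mxE !eqxx /=; ring.
Qed.

Let near_line (P : R -> Prop) y : (\forall s \near dotv y y, P s) ->
  \forall t \near (0 : R), P (dotv (y + t *: e_) (y + t *: e_)).
Proof.
move=> Ps.
have : (fun t : R => dotv (y + t *: e_) (y + t *: e_)) @ (0 : R) --> dotv y y.
  rewrite (_ : (fun _ => _) = (fun t : R => dotv y y + (2 * t * y 0 j + t * t))).
    rewrite [X in _ --> X](_ : _ = dotv y y + (2 * 0 * y 0 j + 0 * 0)).
      apply: cvgD; first exact: cvg_cst.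
      apply: cvgD; last by apply: cvgM; exact: cvg_id.
      apply: cvgM; last exact: cvg_cst.
      by apply: cvgM; [exact: cvg_cst|exact: cvg_id].
    by rewrite !mulr0 mul0r !addr0.
  by apply/funext => t; exact: sqnorm_line.
exact.
Qed.

Let derFu_in y : dotv y y < 1 -> is_derive y e_ Fu (dFu y).
Proof.
move=> y1.
have E : is_derive y e_ (fun y => J (dotv y y) * u y) (dFu y).
  have -> : dFu y = J (dotv y y) * du y +
      u y * (h (dotv y y) / 2 * (2 * dotv y e_)) by rewrite dotv_delta /dFu; field.
  apply: is_derive_mul => //.
  apply: (@is_derive_comp1 _ _ J (fun y => dotv y y)).
    by apply: dJ; rewrite dotvv_ge0 ltW.
  exact: is_derive_sqnorm.
apply/is_derive_line0; move/is_derive_line0: E.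
apply: near_eq_is_derive.
have := @near_line (fun s => mn s = s) y; move=> H.
near=> t; rewrite /Fu; congr (J _ * _); apply/esym.
near: t; apply: H; near=> s; apply: mn_le; apply: ltW.
by near: s; exact: lt_nbhsl.
Unshelve. all: by end_near. Qed.

Let derFu_out y : 1 < dotv y y -> is_derive y e_ Fu 0.
Proof.
move=> y1; apply/is_derive_line0.
have : is_derive (0 : R) 1 (fun _ : R => 0 : R) 0 by exact: is_derive_cst.
apply: near_eq_is_derive.
have := @near_line (fun s => 1 <= s) y; move=> H.
near=> t; rewrite Fu_out//.
near: t; apply: H; near=> s; apply: ltW.
by near: s; exact: lt_nbhsr.
Unshelve. all: by end_near. Qed.

Let D1 := rt @^-1` eball 1.
Let D2 := rt @^-1` eball 2.

Let mD1 : measurable D1. Proof. exact: measurable_eball. Qed.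
Let mD2 : measurable D2. Proof. exact: measurable_eball. Qed.

Let ldFu : lbm dFu.
Proof.
apply: lbmD.
  apply: lbmM => //; apply: lbmM; last exact: lbm_coord.
  apply: (@lbm_comp _ _ h (fun y => dotv y y)) => //; exact: lbm_sqnorm.
apply: lbmM => //.
apply: (@lbm_comp _ _ J (fun y => dotv y y)) => //; exact: lbm_sqnorm.
Qed.

Let iFu : mu.-integrable setT (EFin \o (Fu \o rt)).
Proof.
have := lbm_integrable (@ler01 R) lFu; rewrite integrable_mkcond//.
congr (mu.-integrable setT _); apply/funext => t; rewrite patchE.
case: ifPn => // /negP tD; rewrite /= Fu_out//.
have := tD; rewrite inE /preimage /= eballE// expr1n => /negP.
by rewrite -ltNge => /ltW.
Qed.

(** This bound dominates the difference quotients. If [y] is outside [B(2)], both points lie outside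
    the open unit ball, where [Fu] vanishes; otherwise the increments of the two factors are bounded
    separately, and [B(4)] contains the segments involved. *)
Let Fu_lip : exists2 K, 0 <= K & forall y (t : R), 0 < t <= 1 ->
  `|Fu (y + t *: e_) - Fu y| <= K * t * \1_(eball 2) y.
Proof.
have [L HL] := continuous_bounded_on 0 1 ch.
have [M HM] := lu.2 4.
have [M' HM'] := ldu.2 4.
have L0 : 0 <= L by apply: le_trans (HL 0 _); rewrite ?lexx ?ler01.
have e0 : enorm (0 : 'rV[R]_m) <= 4.
  rewrite /enorm (_ : dotv 0 0 = 0) ?sqrtr0//.
  by rewrite /dotv big1// => i _; rewrite mxE mul0r.
have M0 : 0 <= M by apply: le_trans (HM 0 e0).
have M'0 : 0 <= M' by apply: le_trans (HM' 0 e0).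
have Jlip s s' : 0 <= s -> 0 <= s' ->
    `|J (mn s') - J (mn s)| <= L * `|s' - s|.
  move=> s0 s'0.
  apply: le_trans (ler_wpM2l L0 (mn_lip s s')).
  apply: (@lipschitz_of_derive J (fun s => h s / 2) 0 1) => //; try exact: mn01.
  move=> x x01; rewrite normrM [`|2^-1|]ger0_norm// ler_pdivrMr//.
  by apply: le_trans (HL _ x01) _; rewrite ler_peMr// ler1n.
have y4 y (s : R) : enorm y <= 2 -> 0 <= s <= 1 -> enorm (y + s *: e_) <= 4.
  move=> /(@eballE R m 2 y (ler0n _ _)) y2 /andP[s0 s1].
  apply/eballE => //; rewrite sqnorm_line.
  have yj : y 0 j ^+ 2 <= 2 ^+ 2 by exact: le_trans (coord_le_dotv y j) y2.
  have yj2 : `|y 0 j| <= 2.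
    by rewrite -(@ler_pXn2r _ 2)// ?nnegrE// real_normK ?num_real.
  move: yj2; rewrite ler_norml => /andP[_ yj2].
  have : s * y 0 j <= 2.
    rewrite -[leRHS]mul1r; have [yj0|yj0] := leP 0 (y 0 j).
      by apply: ler_pM.
    apply: (@le_trans _ _ 0); last by rewrite mul1r.
    by rewrite mulr_ge0_le0// ltW.
  have : s * s <= 1 by rewrite mulr_ile1.
  by move: y2; rewrite !expr2; nra.
have ulip y (t : R) : enorm y <= 2 -> 0 < t <= 1 ->
    `|u (y + t *: e_) - u y| <= M' * t.
  move=> y2 /andP[t0 t1].
  have -> : u y = u (y + (0 : R) *: e_) by rewrite scale0r addr0.
  have -> : M' * t = M' * `|t - 0| by rewrite subr0 gtr0_norm.
  apply: (@lipschitz_of_derive (fun s : R => u (y + s *: e_))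
    (fun s => du (y + s *: e_)) 0 1).
  - by move=> s _; apply: (is_derive_line u y e_ s _).1; exact: deru.
  - by move=> s s01; apply: HM'; exact: y4.
  - by rewrite lexx ler01.
  - by rewrite (ltW t0).
(* Since [|y_j| <= 2] and [t <= 1], the shift changes [|y|^2] by at most [5 t]. Since [J 1 = 0] and
   [|y|^2] is within distance 3 of 1, the factor containing [J] is at most [3 L]. *)
exists (L * 5 * M + L * 3 * M'); first by rewrite addr_ge0// !mulr_ge0.
move=> y t /andP[t0 t1].
have t01 : 0 <= t <= 1 by rewrite (ltW t0).
rewrite indicE; case: (boolP (y \in _)) => [|/negP]; rewrite inE; last first.
  move=> /(eballE y (ler0n R 2)) /negP; rewrite -ltNge => y2.
  rewrite mulr0 !Fu_out ?subrr ?normr0//.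
    by apply: ltW; apply: le_lt_trans y2; rewrite expr2; lra.
  rewrite sqnorm_line.
  have : y 0 j ^+ 2 <= dotv y y by exact: coord_le_dotv.
  set S := dotv y y in y2 *; set z := y 0 j; rewrite expr2 in y2 *.
  rewrite expr2 => zS.
  (* This square gives [2 t z >= - z^2 / 2 - 2 t^2], whence [S + 2 t z + t^2 >= S / 2 - 1 > 1]. *)
  have := sqr_ge0 (z + 2 * t); rewrite expr2 => H.
  have : t * t <= 1 by rewrite mulr_ile1// ltW.
  by move: H zS y2; nra.
move=> y2; rewrite mulr1.
have /(eballE y (ler0n R 2)) y2' := y2.
rewrite /Fu (_ : _ - _ = (J (mn (dotv (y + t *: e_) (y + t *: e_))) - J (mn (dotv y y)))
   * u (y + t *: e_) + J (mn (dotv y y)) * (u (y + t *: e_) - u y)); last by ring.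
apply: le_trans (ler_normD _ _) _; rewrite !normrM mulrDl; apply: lerD.
  rewrite mulrAC; apply: ler_pM => //; last exact/HM/y4.
  apply: le_trans (Jlip _ _ (dotvv_ge0 _) (dotvv_ge0 _)) _.
  rewrite -mulrA ler_wpM2l//.
  have : y 0 j ^+ 2 <= 2 ^+ 2 by exact: le_trans (coord_le_dotv y j) y2'.
  rewrite sqnorm_line addrAC subrr add0r !expr2.
  set z := y 0 j => z2; rewrite ler_norml.
  have zb : - 2 <= z <= 2 by apply/andP; split; nra.
  by move: zb => /andP[zb1 zb2]; apply/andP; split; nra.
rewrite -mulrA; apply: ler_pM => //; last by apply: ulip => //; rewrite t0.
have := Jlip 1 (dotv y y) ler01 (dotvv_ge0 y).
rewrite [mn 1]mn_le// J1 subr0 => /le_trans; apply.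
rewrite ler_wpM2l// ler_norml; have := dotvv_ge0 y.
by move: y2'; rewrite expr2; lra.
Qed.

(** By translation invariance every difference quotient of [Fu] has integral 0. Off the sphere, a
    null set, the quotients converge to [dFu] inside the ball and to 0 outside, and dominated
    convergence concludes. *)
Let integral_dFu : \int[mu]_(t in D1) dFu (rt t) = 0.
Proof.
rewrite Rintegral_mkcond.
pose q (n : nat) t := ((Fu (rt t + n.+1%:R^-1 *: e_) - Fu (rt t)) / n.+1%:R^-1).
pose v (n i : nat) : R := if i == j then n.+1%:R^-1 else 0.
have shift n t : rt (tuple_affine 1 (v n) t) = rt t + n.+1%:R^-1 *: e_.
  rewrite row_of_tuple_affine scale1r; congr (_ + _); apply/rowP => i.
  by rewrite !mxE /v val_eqE eqxx /=; case: (i == j); rewrite (mulr1, mulr0).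
have mq n : measurable_fun setT (EFin \o q n).
  apply/measurable_EFinP; apply: measurable_funM => //.
  apply: measurable_funB; last exact: lFu.1.
  rewrite (_ : (fun _ => _) = (Fu \o rt) \o tuple_affine 1 (v n)).
    by apply: measurableT_comp lFu.1 _; exact: measurable_tuple_affine.
  by apply/funext => t /=; rewrite shift.
have [K K0 HK] := Fu_lip.
have qK n t : `|q n t| <= (cst K \_ D2) t.
  have n01 : 0 < (n.+1%:R^-1 : R) <= 1 by rewrite invr_gt0 ltr0Sn/= invf_le1 ?ler1n.
  have := HK (rt t) _ n01; rewrite /q normrM normfV.
  rewrite [`|_^-1|]gtr0_norm ?invr_gt0// ler_pdivrMr ?invr_gt0//.
  move=> /le_trans; apply; rewrite indicE patchE mulrAC ler_wpM2r//.
  rewrite (_ : (t \in D2) = (rt t \in eball 2)); last first.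
    by apply/idP/idP; rewrite !inE.
  by case: ifP; rewrite (mulr1, mulr0).
have iK : mu.-integrable setT (EFin \o (cst K \_ D2)).
  rewrite -restrict_EFin; apply: (integrable_mkcond _ mD2).1.
  by apply: (@lbm_integrable R m 2 (cst K)) => //; exact: lbm_cst.
have iq n : mu.-integrable setT (EFin \o q n).
  apply: le_integrable iK => //= t _; rewrite lee_fin.
  exact: le_trans (qK n t) (ler_norm _).
have q0 n : (\int[mu]_t (EFin \o q n) t = 0)%E.
  have iF := integrable_affine (v n) ltr01 iFu.
  have E : \int[mu]_t q n t * n.+1%:R^-1 = 0.
    rewrite -RintegralZr//.
    transitivity (\int[mu]_t (((Fu \o rt) \o tuple_affine 1 (v n)) t - (Fu \o rt) t)).
      by apply: eq_Rintegral => t _; rewrite /q divfK//= shift.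
    rewrite RintegralB// (integral_affine (v n) ltr01 iFu).
    by rewrite expr1n mul1r subrr.
  have := integrable_fin_num measurableT (iq n) => /fineK <-.
  move/eqP: E; rewrite mulf_eq0 invr_eq0 pnatr_eq0 orbF => /eqP E.
  by congr EFin; exact: E.
have [||//||_ _ H] := @dominated_convergence _ _ _ mu setT measurableT
  (fun n => EFin \o q n) (EFin \o ((dFu \o rt) \_ D1))
  (EFin \o ((cst K) \_ D2)) mq.
- apply/measurable_EFinP; apply: (measurable_restrictT _ mD1).1.
  exact: measurable_funTS ldFu.1.
- exists [set t | dotv (rt t) (rt t) = 1]; split; last first.
  + move=> t; apply: contra_notP => /eqP t1 _ /=.
    apply/cvg_EFin; first by near=> n.
    apply: is_derive_seq; rewrite patchE.
    have [t1'|t1'] := ltP (dotv (rt t) (rt t)) 1.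
      rewrite mem_set; first exact: derFu_in.
      by rewrite /D1 /preimage /= eballE// expr1n ltW.
    rewrite memNset; first by apply: derFu_out; rewrite lt_neqAle eq_sym t1.
    rewrite /D1 /preimage /= eballE// expr1n => t1''.
    by move: t1; rewrite eq_le t1' t1''.
  + exact: sphere_null.
  + rewrite (_ : mkset _ = (fun t => dotv (rt t) (rt t)) @^-1` [set 1])//.
    by rewrite -[X in measurable X]setTI; apply: measurable_sqnorm_row.
- by apply: aeW => t n _ /=; rewrite lee_fin.
have H0 : (\int[mu]_(x in setT) (EFin \o q n) x)%E @[n --> \oo] --> 0%E.
  by under eq_fun do rewrite q0; exact: cvg_cst.
by rewrite /Rintegral -[X in fine X]/(\int[mu]_x ((EFin \o (dFu \o rt) \_ D1) x))%E
  (cvg_unique _ H H0).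
Unshelve. all: by end_near. Qed.

Lemma ball_integration_by_parts :
  Rn_integral (eball 1) (fun y => h (dotv y y) * y 0 j * u y) =
  - Rn_integral (eball 1) (fun y => J (dotv y y) * du y).
Proof.
apply/eqP; rewrite -addr_eq0; apply/eqP; rewrite -[RHS]integral_dFu.
rewrite /Rn_integral -RintegralD//.
  apply: (@lbm_integrable _ _ 1 (fun y => h (dotv y y) * y 0 j * u y)) => //.
  apply: lbmM => //; apply: lbmM; last exact: lbm_coord.
  apply: (@lbm_comp _ _ h (fun y => dotv y y)) => //; exact: lbm_sqnorm.
apply: (@lbm_integrable _ _ 1 (fun y => J (dotv y y) * du y)) => //.
apply: lbmM => //.
apply: (@lbm_comp _ _ J (fun y => dotv y y)) => //; exact: lbm_sqnorm.
Qed.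

End BallIntegrationByParts.

(** * The operator J on continuous functions *)

Section HalfPrimitives.
Context (R : realType).
Implicit Types (f h : R -> R).

Lemma is_derive_continuous f (s d : R) :
  is_derive s 1 f d -> {for s, continuous f}.
Proof. by move=> [/derivable1_diffP/differentiable_continuous]. Qed.

(* [max(-1, s)]: clamping the upper bound of the integral makes the primitive continuous on the
   whole line, although the integral is only differentiated to the right of [-2]. *)
Let max_m1 (s : R) : R := (s - 1 + `|s + 1|) / 2.

(** The base point lies to the left of 0 so that the derivative is two-sided at 0 as well; the
    second integral makes the value at 1 vanish. *)
Definition half_primitive h (s : R) : R :=
  (\int[lebesgue_measure]_(t in `[- 2, max_m1 s]) h t
   - \int[lebesgue_measure]_(t in `[- 2, 1]) h t) / 2.

Let max_m1_id (s : R) : -1 <= s -> max_m1 s = s.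
Proof.
by move=> s1; rewrite /max_m1 ger0_norm; [field|rewrite -lerBlDr sub0r].
Qed.

Let max_m1_ge (s : R) : -1 <= max_m1 s.
Proof.
have [s1|/ltW s1] := leP (-1) s; first by rewrite max_m1_id.
rewrite /max_m1 ler0_norm; last by rewrite -lerBrDr sub0r.
by rewrite (_ : _ / 2 = -1)//; field.
Qed.

Lemma half_primitive1 h : half_primitive h 1 = 0.
Proof.
by rewrite /half_primitive max_m1_id ?subrr ?mul0r// (le_trans (lerN10 R)) ?ler01.
Qed.

Let integral_derive h (s : R) : continuous h -> -1 <= s ->
  is_derive s 1 (fun x => \int[lebesgue_measure]_(t in `[- 2, x]) h t) (h s).
Proof.
move=> ch s1.
have [||//|d1 d2] := @continuous_FTC1_closed R h (-2) s (s + 1) _ _ _ (ch s).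
- by rewrite ltrDl.
- apply: continuous_compact_integrable; first exact: segment_compact.
  exact: continuous_subspaceT.
- by apply: lt_le_trans s1; rewrite ltrN2 ltr1n.
- by apply: DeriveDef; [exact: d1|rewrite derive1E in d2].
Qed.

Lemma is_derive_half_primitive h (s : R) : continuous h -> -1 < s ->
  is_derive s 1 (half_primitive h) (h s / 2).
Proof.
move=> ch s1.
have H : is_derive s 1 (fun x => (\int[lebesgue_measure]_(t in `[- 2, x]) h t
   - \int[lebesgue_measure]_(t in `[- 2, 1]) h t) / 2) (h s / 2).
  have dI := integral_derive ch (ltW s1).
  by apply: is_derive_eq; rewrite /GRing.scale /=; ring.
apply: near_eq_is_derive H.
near=> t; rewrite /half_primitive max_m1_id//; apply: ltW.
by near: t; exact: lt_nbhsr.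
Unshelve. all: by end_near. Qed.

Lemma continuous_half_primitive h : continuous h ->
  continuous (half_primitive h).
Proof.
move=> ch s.
apply: (@continuousM _ _ (fun s => \int[lebesgue_measure]_(t in `[- 2, max_m1 s]) h t
   - \int[lebesgue_measure]_(t in `[- 2, 1]) h t) (cst 2^-1)); last exact: cvg_cst.
apply: continuousB; last exact: cvg_cst.
apply: (@continuous_comp _ _ _ max_m1
  (fun x => \int[lebesgue_measure]_(t in `[- 2, x]) h t)).
  apply: continuousM; last exact: cvg_cst.
  apply: continuousD.
    by apply: continuousB; [exact: cvg_id|exact: cvg_cst].
  apply: continuous_comp; last exact: norm_continuous.
  by apply: continuousD; [exact: cvg_id|exact: cvg_cst].
exact: is_derive_continuous (integral_derive ch (max_m1_ge s)).
Qed.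

Lemma continuous_iter_half_primitive h n : continuous h ->
  continuous (iter n half_primitive h).
Proof. by move=> ch; elim: n => //= n; exact: continuous_half_primitive. Qed.

Lemma is_derive_iter_half_primitive h n (s : R) : continuous h -> 0 <= s <= 1 ->
  is_derive s 1 (iter n.+1 half_primitive h) (iter n half_primitive h s / 2).
Proof.
move=> ch /andP[s0 _]; apply: is_derive_half_primitive.
  exact: continuous_iter_half_primitive.
exact: lt_le_trans (ltrN10 R) s0.
Qed.

End HalfPrimitives.

(** * Homogeneous polynomials and their partial derivatives *)

Section HomogeneousPolynomials.
Context (R : realType) (m : nat).
Implicit Types f g : 'rV[R]_m -> R.
Local Notation E j := (delta_mx 0 j : 'rV[R]_m).

Definition partial (j : 'I_m) f (x : 'rV[R]_m) : R := 'D_(E j) f x.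

(* Homogeneous polynomials of degree [l], in the recursive form suited to induction on [l]. *)
Fixpoint hpoly (l : nat) (f : 'rV[R]_m -> R) : Prop :=
  if l is l'.+1 then
    exists2 g : 'I_m -> 'rV[R]_m -> R, (forall j, hpoly l' (g j)) &
      f = fun x => \sum_j x 0 j * g j x
  else exists c, f = fun=> c.

Lemma hpolyZ l a f : hpoly l f -> hpoly l (fun x => a * f x).
Proof.
elim: l f => [|l IH] f; first by move=> [c ->]; exists (a * c).
move=> [g hg ->]; exists (fun j x => a * g j x) => [j|]; first exact: (IH _ (hg j)).
by apply/funext => x; rewrite mulr_sumr; apply: eq_bigr => j _; rewrite mulrCA.
Qed.

Lemma hpolyD l f g : hpoly l f -> hpoly l g -> hpoly l (fun x => f x + g x).
Proof.
elim: l f g => [|l IH] f g; first by move=> [c ->] [d ->]; exists (c + d).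
move=> [f' hf ->] [g' hg ->]; exists (fun j x => f' j x + g' j x) => [j|].
  exact: (IH _ _ (hf j) (hg j)).
apply/funext => x; rewrite -big_split; apply: eq_bigr => j _ /=.
by rewrite mulrDr.
Qed.

Lemma hpoly0 l : hpoly l (fun=> 0).
Proof.
elim: l => [|l IH]; first by exists 0.
exists (fun _ _ => 0) => //.
by apply/funext => x; rewrite big1// => j _; rewrite mulr0.
Qed.

Lemma hpoly_sum (I : Type) (s : seq I) (P : pred I) l (f : I -> 'rV[R]_m -> R) :
  (forall i, hpoly l (f i)) -> hpoly l (fun x => \sum_(i <- s | P i) f i x).
Proof.
move=> hf; elim: s => [|i s IH].
  by under eq_fun do rewrite big_nil; exact: hpoly0.
under eq_fun do rewrite big_cons.
by case: (P i) => //; exact: hpolyD.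
Qed.

Lemma hpoly_coordM l j f : hpoly l f -> hpoly l.+1 (fun x => x 0 j * f x).
Proof.
move=> hf; exists (fun i x => (i == j)%:R * f x) => [i|]; first exact: (hpolyZ _ hf).
apply/funext => x; rewrite (bigD1 j)//= eqxx mul1r big1 ?addr0// => i ij.
by rewrite (negPf ij) mul0r mulr0.
Qed.

Lemma hpoly_lbm l f : hpoly l f -> lbm f.
Proof.
elim: l f => [|l IH] f; first by move=> [c ->]; exact: lbm_cst.
move=> [g hg ->]; apply: lbm_sum => j.
by apply: lbmM; [exact: lbm_coord|exact: IH (hg j)].
Qed.

Lemma hpoly_scale l f s x : hpoly l f -> f (s *: x) = s ^+ l * f x.
Proof.
elim: l f => [|l IH] f; first by move=> [c ->]; rewrite mul1r.
move=> [g hg ->]; rewrite mulr_sumr; apply: eq_bigr => j _.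
by rewrite mxE (IH _ (hg j)) exprS; ring.
Qed.

Lemma hpoly_derivable l f j x : hpoly l f -> derivable f x (E j).
Proof.
elim: l f => [|l IH] f; first by move=> [c ->]; exact: derivable_cst.
move=> [g hg ->].
have H : is_derive x (E j) (fun x => \sum_j x 0 j * g j x)
    (\sum_i (x 0 i * 'D_(E j) (g i) x + g i x * (E j) 0 i)).
  apply: is_derive_bigsum => i; apply: is_derive_mul.
    exact: is_derive_coord.
  exact/derivableP/(IH _ (hg i)).
by case: H.
Qed.

Lemma hpoly_is_derive l f j x : hpoly l f -> is_derive x (E j) f (partial j f x).
Proof. by move=> hf; apply/derivableP; apply: hpoly_derivable hf. Qed.

Lemma derive_sum_coordM l (g : 'I_m -> 'rV[R]_m -> R) i :
  (forall j, hpoly l (g j)) ->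
  partial i (fun x => \sum_j x 0 j * g j x) =
  fun x => g i x + \sum_j x 0 j * partial i (g j) x.
Proof.
move=> hg; apply/funext => x; apply: derive_val.
have -> : g i x + \sum_j x 0 j * partial i (g j) x =
    \sum_j (x 0 j * partial i (g j) x + g j x * (E i) 0 j).
  rewrite big_split /= addrC; congr (_ + _).
  rewrite (bigD1 i)//= mxE !eqxx mulr1 big1 ?addr0// => j ji.
  by rewrite mxE (negPf ji) andbF mulr0.
apply: is_derive_bigsum => j; apply: is_derive_mul.
  exact: is_derive_coord.
exact: hpoly_is_derive (hg j).
Qed.

(** In degree 0 the derivative is the constant 0, which again has degree 0, so the truncated
    predecessor is correct. *)
Lemma hpoly_derive l f i : hpoly l f -> hpoly l.-1 (partial i f).
Proof.
elim: l f => [|l IH] f.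
  move=> [c ->]; exists 0; apply/funext => x; exact: derive_cst.
move=> [g hg ->]; rewrite (derive_sum_coordM _ hg) /=.
apply: hpolyD (hg i) _; apply: hpoly_sum => j.
case: l IH hg => [|l] IH hg; last by apply: hpoly_coordM; exact: (IH _ (hg j)).
have [c gc] := hg j; exists 0; apply/funext => x.
by rewrite gc /partial derive_cst mulr0.
Qed.

Lemma hpoly_euler l f (x : 'rV[R]_m) : hpoly l f -> \sum_i x 0 i * partial i f x = l%:R * f x.
Proof.
elim: l f => [|l IH] f.
  move=> [c ->]; rewrite mul0r big1// => i _.
  by rewrite /partial derive_cst mulr0.
move=> [g hg ->].
transitivity (\sum_i (x 0 i * g i x + \sum_j x 0 i * (x 0 j * partial i (g j) x))).
  apply: eq_bigr => i _.
  by have /(congr1 (fun F => F x)) -> := derive_sum_coordM i hg;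
    rewrite mulrDr mulr_sumr.
rewrite big_split exchange_big /= -natr1 mulrDl mul1r addrC; congr (_ + _).
rewrite mulr_sumr; apply: eq_bigr => j _.
by rewrite mulrCA -(IH _ (hg j)) mulr_sumr; apply: eq_bigr => i _; rewrite mulrCA.
Qed.

(** For [f = sum_j x_j g_j] the second derivative is [D_a g_b + D_b g_a + sum_j x_j D_a D_b g_j],
    where the first two terms are exchanged with [a] and [b] and the sum is symmetric by
    induction. *)
Lemma hpoly_deriveC l f a b : hpoly l f -> partial a (partial b f) = partial b (partial a f).
Proof.
elim: l f => [|l IH] f.
  move=> [c ->]; apply/funext => x.
  have D0 k : partial k (fun=> c) = fun=> 0 by apply/funext => y; exact: derive_cst.
  by rewrite !D0 /partial !derive_cst.
move=> [g hg ->]; rewrite (derive_sum_coordM b hg) (derive_sum_coordM a hg).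
have D i k : partial k (fun x => g i x + \sum_j x 0 j * partial i (g j) x) =
    fun x => partial k (g i) x + (partial i (g k) x +
      \sum_j x 0 j * partial k (partial i (g j)) x).
  have hd j := hpoly_derive i (hg j).
  apply/funext => x; have := derive_sum_coordM k hd.
  move=> /(congr1 (fun F => F x)) <-.
  rewrite {1}/partial deriveD//; first exact: hpoly_derivable (hg i).
  by apply: (@hpoly_derivable l.-1.+1); exists (fun j => partial i (g j)).
apply/funext => x.
have /(congr1 (fun F => F x)) Ea := D b a.
have /(congr1 (fun F => F x)) Eb := D a b.
apply: etrans Ea _; apply/esym; apply: etrans Eb _.
have swap (p q s s' : R) : s = s' -> p + (q + s) = q + (p + s').
  by move=> ->; rewrite addrCA.
apply: swap; apply: eq_bigr => j _; apply: congr1.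
exact: (congr1 (fun F => F x) (esym (IH _ (hg j)))).
Qed.

End HomogeneousPolynomials.

(** * Cosine transforms over the ball and Bochner's formula *)

Section BallFourier.
Context (R : realType) (m : nat).
Implicit Types f g : 'rV[R]_m -> R.
Local Notation E j := (delta_mx 0 j : 'rV[R]_m).
Local Notation ballint f := (Rn_integral (eball 1) f).

Lemma ballintD f g : lbm f -> lbm g ->
  ballint (fun y => f y + g y) = ballint f + ballint g.
Proof.
by move=> lf lg; rewrite /Rn_integral RintegralD//;
  [exact: measurable_eball|exact: lbm_integrable ler01 lf
  |exact: lbm_integrable ler01 lg].
Qed.

Lemma ballintZ (a : R) f : lbm f -> ballint (fun y => a * f y) = a * ballint f.
Proof.
by move=> lf; rewrite /Rn_integral RintegralZl//;
  [exact: measurable_eball|exact: lbm_integrable ler01 lf].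
Qed.

Lemma eq_ballint f g : f =1 g -> ballint f = ballint g.
Proof. by move=> fg; congr (Rn_integral _ _); apply/funext. Qed.

Lemma ballintN f : lbm f -> ballint (fun y => - f y) = - ballint f.
Proof.
by move=> lf; rewrite -mulN1r -ballintZ//; apply: eq_ballint => y; rewrite mulN1r.
Qed.

Lemma ballint0 f : (forall y, f y = 0) -> ballint f = 0.
Proof.
move=> f0; transitivity (0 * ballint (fun _ : 'rV[R]_m => 0)); last by rewrite mul0r.
rewrite -ballintZ; last exact: lbm_cst.
by apply: eq_ballint => y; rewrite f0 mul0r.
Qed.

Lemma ballint_sum (I : Type) (s : seq I) (P : pred I) (f : I -> 'rV[R]_m -> R) :
  (forall i, lbm (f i)) ->
  ballint (fun y => \sum_(i <- s | P i) f i y) = \sum_(i <- s | P i) ballint (f i).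
Proof.
move=> lf; elim: s => [|i s IH].
  by rewrite big_nil ballint0// => y; rewrite big_nil.
rewrite big_cons -IH; case: ifPn => Pi.
  rewrite -ballintD//; last exact: lbm_sum.
  by apply: eq_ballint => y; rewrite big_cons Pi.
by apply: eq_ballint => y; rewrite big_cons (negPf Pi).
Qed.

Lemma lbm_radial (h : R -> R) : continuous h -> lbm (fun y : 'rV[R]_m => h (dotv y y)).
Proof.
by move=> ch; apply: (@lbm_comp _ _ h (fun y => dotv y y)) => //; exact: lbm_sqnorm.
Qed.

Definition harmonic_fun f := forall x, \sum_j partial j (partial j f) x = 0.

(** The Laplacian commutes with [D_i]. This is what lets Bochner's formula be proved by induction on
    the degree. *)
Lemma harmonic_partial l f i : hpoly l f -> harmonic_fun f -> harmonic_fun (partial i f).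
Proof.
move=> hf Hf x.
transitivity (partial i (fun x => \sum_j partial j (partial j f) x) x).
  apply/esym/derive_val; apply: is_derive_bigsum => j.
  rewrite (hpoly_deriveC _ _ hf) (hpoly_deriveC _ _ (hpoly_derive j hf)).
  exact: hpoly_is_derive (hpoly_derive j (hpoly_derive j hf)).
rewrite (_ : (fun _ => _) = fun=> 0); first exact: derive_cst.
by apply/funext => y; exact: Hf.
Qed.

(** Writing the sine as a cosine of shifted phase keeps the family of integrands closed under
    differentiation. *)
Lemma is_derive_cos_dotv (z : 'rV[R]_m) (phi : R) (y : 'rV[R]_m) j :
  is_derive y (E j) (fun y => cos (dotv z y + phi))
    (- (z 0 j * cos (dotv z y + (phi - pi / 2)))).
Proof.
have -> : - (z 0 j * cos (dotv z y + (phi - pi / 2))) =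
    - sin (dotv z y + phi) * (dotv z (E j) + 0).
  by rewrite addrA cosBpihalf addr0 mulNr mulrC dotv_delta.
apply: (@is_derive_comp1 _ _ cos (fun y => dotv z y + phi)).
by apply: is_derive_add; exact: is_derive_dotv.
Qed.

(** A Fourier integral over the ball in real form: [phi = 0] gives the cosine part and
    [phi = - pi / 2] the sine part. *)
Definition cosint (phi : R) (h : R -> R) f (z : 'rV[R]_m) : R :=
  ballint (fun y => cos (dotv z y + phi) * h (dotv y y) * f y).

Definition cosint1 (phi : R) (h : R -> R) := cosint phi h (fun=> 1).

Lemma lbm_cosint1 (phi : R) (h : R -> R) (z : 'rV[R]_m) : continuous h ->
  lbm (fun y => cos (dotv z y + phi) * h (dotv y y) * 1).
Proof.
by move=> ch; apply: lbmM; [apply: lbmM; [exact: lbm_cos|exact: lbm_radial]|exact: lbm_cst].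
Qed.

Lemma cosint1D (phi : R) (h1 h2 : R -> R) z : continuous h1 -> continuous h2 ->
  cosint1 phi (fun s => h1 s + h2 s) z = cosint1 phi h1 z + cosint1 phi h2 z.
Proof.
move=> c1 c2; rewrite /cosint1 /cosint -ballintD; try exact: lbm_cosint1.
by apply: eq_ballint => y; ring.
Qed.

Lemma cosint1Z (phi a : R) (h : R -> R) z : continuous h ->
  cosint1 phi (fun s => a * h s) z = a * cosint1 phi h z.
Proof.
move=> ch; rewrite /cosint1 /cosint -ballintZ; last exact: lbm_cosint1.
by apply: eq_ballint => y; ring.
Qed.

(** Up to sign, the derivative of [cosint1 phi h] at [z] in the direction [w]. *)
Definition sinint_lin (phi : R) (h : R -> R) (w z : 'rV[R]_m) : R :=
  ballint (fun y => h (dotv y y) * dotv w y * cos (dotv z y + (phi - pi / 2))).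

Section pair.
Context (h Jh : R -> R) (ch : continuous h) (cJh : continuous Jh).
Context (dJh : forall s : R, 0 <= s <= 1 -> is_derive s 1 Jh (h s / 2)).
Context (Jh1 : Jh 1 = 0).

(** Each [y_j] is integrated by parts. The derivative shifts the phase by a second quarter turn, and
    a half turn in all reverses the sign of the cosine. *)
Lemma sinint_lin_parts phi w z :
  sinint_lin phi h w z = - dotv w z * cosint1 phi Jh z.
Proof.
have lh := lbm_radial ch; have lJh := lbm_radial cJh.
have lc := lbm_cos z phi; have lc' := lbm_cos z (phi - pi / 2).
transitivity (\sum_j w 0 j * ballint (fun y => h (dotv y y) * y 0 j *
    cos (dotv z y + (phi - pi / 2)))).
  have L j : lbm (fun y => h (dotv y y) * y 0 j * cos (dotv z y + (phi - pi / 2))).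
    by apply: lbmM => //; apply: lbmM => //; exact: lbm_coord.
  under eq_bigr do rewrite -ballintZ//.
  rewrite -ballint_sum; last by move=> j; apply: lbmM => //; exact: lbm_cst.
  apply: eq_ballint => y; rewrite /dotv mulr_sumr mulr_suml.
  by apply: eq_bigr => j _; ring.
rewrite /dotv mulNr mulr_suml -sumrN; apply: eq_bigr => j _.
have d y := is_derive_cos_dotv z (phi - pi / 2) y j.
have lcc : lbm (fun y => - (z 0 j * cos (dotv z y + (phi - pi / 2 - pi / 2)))).
  by apply: lbmN; apply: lbmM; [exact: lbm_cst|exact: lbm_cos].
rewrite (ball_integration_by_parts ch cJh dJh Jh1 lc' lcc d) mulrN -mulrA.
congr (- (_ * _)); rewrite -ballintZ; last exact: lbm_cosint1.
apply: eq_ballint => y.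
rewrite (_ : dotv z y + (phi - pi / 2 - pi / 2) = dotv z y + phi - pi / 2 - pi / 2).
  by rewrite cosBpihalf sinBpihalf; ring.
by ring.
Qed.

(** Of the two factors in [y_j y_j], one is integrated by parts; differentiating the other produces
    the [m], and differentiating the cosine produces [sinint_lin]. *)
Lemma cosint1_sqnorm_parts phi z :
  cosint1 phi (fun s => s * h s) z = - (m%:R * cosint1 phi Jh z) + sinint_lin phi Jh z z.
Proof.
have lh := lbm_radial ch; have lJh := lbm_radial cJh.
have lc := lbm_cos z phi; have lc' := lbm_cos z (phi - pi / 2).
have L j : lbm (fun y => h (dotv y y) * y 0 j * (y 0 j * cos (dotv z y + phi))).
  by apply: lbmM; apply: lbmM => //; exact: lbm_coord.
transitivity (\sum_j ballint (fun y => h (dotv y y) * y 0 j *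
    (y 0 j * cos (dotv z y + phi)))).
  rewrite -ballint_sum//.
  apply: eq_ballint => y; rewrite mulr1 {2}/dotv !mulr_suml mulr_sumr.
  by apply: eq_bigr => j _; ring.
pose du j (y : 'rV[R]_m) := y 0 j * (- (z 0 j * cos (dotv z y + (phi - pi / 2)))) +
  cos (dotv z y + phi) * (E j) 0 j.
have d j y : is_derive y (E j) (fun y => y 0 j * cos (dotv z y + phi)) (du j y).
  by apply: is_derive_mul; [exact: is_derive_coord|exact: is_derive_cos_dotv].
have lu j : lbm (fun y => y 0 j * cos (dotv z y + phi)).
  by apply: lbmM => //; exact: lbm_coord.
have ls j : lbm (fun y => y 0 j * (- (z 0 j * cos (dotv z y + (phi - pi / 2))))).
  apply: lbmM; first exact: lbm_coord.
  by apply: lbmN; apply: lbmM => //; exact: lbm_cst.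
have ldu j : lbm (du j) by apply: lbmD => //; apply: lbmM => //; exact: lbm_cst.
under eq_bigr do rewrite (ball_integration_by_parts ch cJh dJh Jh1 (lu _) (ldu _) (d _)).
rewrite sumrN -ballint_sum; last by move=> j; exact: lbmM.
have l1 : lbm (fun y => Jh (dotv y y) * dotv z y * cos (dotv z y + (phi - pi / 2))).
  by apply: lbmM => //; apply: lbmM => //; exact: lbm_dotv.
rewrite -ballintN; last first.
  by apply: lbm_sum => j; exact: lbmM.
rewrite /cosint1 /cosint /sinint_lin -ballintZ; last exact: lbm_cosint1.
rewrite -ballintN; last by apply: lbmM; [exact: lbm_cst|exact: lbm_cosint1].
rewrite -ballintD//; last first.
  by apply: lbmN; apply: lbmM; [exact: lbm_cst|exact: lbm_cosint1].
apply: eq_ballint => y; rewrite -mulr_sumr /du big_split /=.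
rewrite (eq_bigr (fun j => - (z 0 j * y 0 j * cos (dotv z y + (phi - pi / 2)))));
  last by move=> j _; ring.
rewrite sumrN -mulr_suml -/(dotv z y).
rewrite (eq_bigr (fun=> cos (dotv z y + phi))); last first.
  by move=> j _; rewrite mxE !eqxx mulr1.
by rewrite sumr_const card_ord -mulr_natr; ring.
Qed.

End pair.

(** Differentiation under the integral sign: the derivative of the integrand is dominated by
    [|h(|y|^2) <w, y>|], uniformly in [r]. *)
Lemma is_derive_cosint1_ray (phi : R) (h : R -> R) (w : 'rV[R]_m) (r : R) : continuous h ->
  is_derive r 1 (fun r => cosint1 phi h (r *: w)) (- sinint_lin phi h w (r *: w)).
Proof.
move=> ch.
have lh := lbm_radial ch.
pose f (r : R) t := cos (dotv (r *: w) (row_of_tuple t) + phi) *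
  h (dotv (row_of_tuple t) (row_of_tuple t)) * 1.
have df (s : R) t : is_derive s 1 (f ^~ t)
    (- (h (dotv (row_of_tuple t) (row_of_tuple t)) * dotv w (row_of_tuple t) *
        cos (dotv (s *: w) (row_of_tuple t) + (phi - pi / 2)))).
  rewrite addrA cosBpihalf /f.
  rewrite (_ : (fun _ => _) = (fun s : R => cos (s * dotv w (row_of_tuple t) + phi) *
     h (dotv (row_of_tuple t) (row_of_tuple t)))); last first.
    by apply/funext => s'; rewrite dotvZ mulr1.
  rewrite dotvZ; set c1 := dotv w _; set c2 := h _.
  have d1 : is_derive s 1 (fun s : R => s * c1 + phi) c1.
    by apply: is_derive_eq; rewrite /GRing.scale /=; ring.
  have d2 := @is_derive1_comp _ cos (fun s : R => s * c1 + phi) s _ _ (is_derive_cos _) d1.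
  have -> : - (c2 * c1 * sin (s * c1 + phi)) =
    cos (s * c1 + phi) * 0 + c2 * (- sin (s * c1 + phi) * c1) by ring.
  by apply: is_derive_mul.
have rI : `]r - 1, r + 1[%classic r by rewrite /= in_itv/= gtrBl ltrDl ltr01.
have mB := @measurable_eball R m 1 ler01.
have fi s : `]r - 1, r + 1[%classic s -> (lebesgue_tuple R m).-integrable
    (@row_of_tuple R m @^-1` eball 1) (EFin \o f s).
  by move=> _; exact: lbm_integrable ler01 (lbm_cosint1 phi (s *: w) ch).
pose g (y : 'rV[R]_m) := `|h (dotv y y) * dotv w y|.
have lg : lbm g.
  apply: (@lbm_comp _ _ Num.norm (fun y => h (dotv y y) * dotv w y)).
    exact: norm_continuous.
  by apply: lbmM => //; exact: lbm_dotv.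
have gi := lbm_integrable ler01 lg.
have derf s t : `]r - 1, r + 1[%classic s -> (@row_of_tuple R m @^-1` eball 1) t ->
    derivable (f ^~ t) s 1 by case: (df s t).
have d1f s t : partial1of2 f s t = - (h (dotv (row_of_tuple t) (row_of_tuple t)) *
     dotv w (row_of_tuple t) * cos (dotv (s *: w) (row_of_tuple t) + (phi - pi / 2))).
  by rewrite partial1of2E; apply: derive_val.
have gub s t : `]r - 1, r + 1[%classic s -> (@row_of_tuple R m @^-1` eball 1) t ->
    `|partial1of2 f s t| <= (g \o @row_of_tuple R m) t.
  move=> _ _; rewrite d1f normrN normrM /= /g ler_piMr//.
  by rewrite ler_norml cos_geN1 cos_le1.
have g0 t : 0 <= (g \o @row_of_tuple R m) t by rewrite /= /g.
have D1 := derivable_under_integral mB rI fi derf g0 gi gub.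
have D2 := differentiation_under_integral mB rI fi derf g0 gi gub.
apply: DeriveDef; first exact: D1.
rewrite -derive1E; apply: etrans D2 _.
rewrite -ballintN; last first.
  by apply: lbmM; [apply: lbmM => //; exact: lbm_dotv|exact: lbm_cos].
by apply: eq_Rintegral => t _; rewrite d1f.
Qed.

Context (J : nat -> R -> R) (cJ : forall n, continuous (J n)).
Context (dJ : forall n (s : R), 0 <= s <= 1 -> is_derive s 1 (J n.+1) (J n s / 2)).
Context (J1 : forall n, J n.+1 1 = 0).

Lemma ballint_parts n j u du : lbm u -> lbm du ->
  (forall y, is_derive y (E j) u (du y)) ->
  ballint (fun y => J n (dotv y y) * y 0 j * u y) =
  - ballint (fun y => J n.+1 (dotv y y) * du y).
Proof.
by move=> lu ldu; apply: ball_integration_by_parts => //; exact: dJ.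
Qed.

(* Writing l H = sum_j y_j D_j H (Euler) and integrating each y_j h(|y|^2) by parts
   moves a derivative onto the cosine, the other terms adding up to the Laplacian of H. *)
Lemma cosint_harmonic l f n phi z : hpoly l f -> harmonic_fun f ->
  cosint phi (J n) f z =
  f z * cosint (phi - l%:R * (pi / 2)) (J (n + l)) (fun=> 1) z.
Proof.
elim: l f n phi => [|l IH] f n phi hf Hf.
  have [c ->] := hf; rewrite mul0r subr0 addn0 /cosint -ballintZ; last first.
    by apply: lbmM; [apply: lbmM; [exact: lbm_cos|exact: lbm_radial]|exact: lbm_cst].
  by apply: eq_ballint => y; ring.
have l0 : l.+1%:R != 0 :> R by rewrite pnatr_eq0.
apply: (mulfI l0).
have ld j : lbm (partial j f) := hpoly_lbm (hpoly_derive j hf).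
have ldd j : lbm (partial j (partial j f)) :=
  hpoly_lbm (hpoly_derive j (hpoly_derive j hf)).
have lc := lbm_cos z phi; have lc' := lbm_cos z (phi - pi / 2).
have lJ := lbm_radial (@cJ n); have lJ' := lbm_radial (@cJ n.+1).
pose u j y := cos (dotv z y + phi) * partial j f y.
pose w y := J n.+1 (dotv y y) * (cos (dotv z y + phi)).
pose du j y := cos (dotv z y + phi) * partial j (partial j f) y +
  partial j f y * (- (z 0 j * cos (dotv z y + (phi - pi / 2)))).
have lu j : lbm (u j) by exact: lbmM.
have ldu j : lbm (du j).
  apply: lbmD; first exact: lbmM.
  by apply: lbmM => //; apply: lbmN; apply: lbmM => //; exact: lbm_cst.
transitivity (\sum_j ballint (fun y => J n (dotv y y) * y 0 j * u j y)).
  rewrite /cosint -ballintZ; last first.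
    by apply: lbmM; [exact: lbmM|exact: hpoly_lbm hf].
  rewrite -ballint_sum; last first.
    by move=> j; apply: lbmM => //; apply: lbmM => //; exact: lbm_coord.
  apply: eq_ballint => y.
  rewrite mulrCA -(hpoly_euler y hf) mulr_sumr; apply: eq_bigr => j _.
  by rewrite /u; ring.
transitivity (\sum_j z 0 j * cosint (phi - pi / 2) (J n.+1) (partial j f) z -
    ballint (fun y => w y * \sum_j partial j (partial j f) y)).
  transitivity (\sum_j (z 0 j * cosint (phi - pi / 2) (J n.+1) (partial j f) z -
      ballint (fun y => w y * partial j (partial j f) y))).
    apply: eq_bigr => j _.
    have dd y : is_derive y (E j) (u j) (du j y).
      apply: is_derive_mul; first exact: is_derive_cos_dotv.
      exact: hpoly_is_derive (hpoly_derive j hf).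
    rewrite (ballint_parts n (lu j) (ldu j) dd).
    rewrite /cosint -ballintZ; last by apply: lbmM => //; exact: lbmM.
    rewrite -!ballintN -?ballintD.
    - by apply: eq_ballint => y; rewrite /du /w; ring.
    - by apply: lbmM; [exact: lbm_cst|apply: lbmM => //; exact: lbmM].
    - by apply: lbmN; apply: lbmM => //; exact: lbmM.
    - by apply: lbmM => //; exact: lbmM.
    - by apply: lbmM.
  rewrite sumrB; congr (_ - _); rewrite -ballint_sum; last first.
    by move=> j; apply: lbmM => //; exact: lbmM.
  by apply: eq_ballint => y; rewrite mulr_sumr.
rewrite [X in _ - X](_ : _ = 0) ?subr0; last first.
  by apply: ballint0 => y; rewrite Hf mulr0.
rewrite [RHS]mulrA -(hpoly_euler z hf) mulr_suml; apply: eq_bigr => j _.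
rewrite (IH _ _ _ (hpoly_derive j hf) (harmonic_partial j hf Hf)).
rewrite addSnnS [LHS]mulrA; congr (_ * _).
rewrite (_ : phi - pi / 2 - l%:R * (pi / 2) = phi - l.+1%:R * (pi / 2)) //.
by rewrite -natr1; ring.
Qed.

(** Applying J to the weight amounts to applying [r^-1 d/dr] to the transform. This is how the
    iterated primitives encode the derivatives of the transform. *)
Lemma is_derive_cosint1_iter n phi (w : 'rV[R]_m) (r : R) : dotv w w = 1 ->
  is_derive r 1 (fun r => cosint1 phi (J n) (r *: w))
    (r * cosint1 phi (J n.+1) (r *: w)).
Proof.
move=> w1; have := is_derive_cosint1_ray phi w r (@cJ n).
rewrite (sinint_lin_parts (@cJ n) (@cJ n.+1) (@dJ n) (J1 n)).
by rewrite dotvC dotvZ w1 mulr1 mulNr opprK.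
Qed.

End BallFourier.

(** * The radial equation: uniqueness, and repeated integration from 1 *)

Section RadialODE.
Context (R : realType).

Lemma derive0_constant (f : R -> R) (a b : R) : a <= b ->
  (forall s, a <= s <= b -> {for s, continuous f}) ->
  (forall s : R, a < s < b -> is_derive s 1 f 0) -> f a = f b.
Proof.
move=> ab cf df.
have df' x : x \in `]a, b[%R -> is_derive x 1 f 0 by rewrite in_itv/= => /df.
have cf' : {within `[a, b], continuous f}.
  by apply: continuous_in_subspaceT => x /set_mem; rewrite /= in_itv/=; exact: cf.
have [c _] := @MVT_segment R f (fun=> 0) a b ab df' cf'.
by rewrite mul0r => /eqP; rewrite subr_eq0 => /eqP.
Qed.

(* The energy [y^2 + (r y1)^2] has derivative at most a multiple of itself:
   the singular terms at r = 0 have the good sign. *)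
Lemma radial_ode_unique (beta A chi : R) (y y1 y2 : R -> R) : 0 <= beta -> 0 <= A ->
  (forall r : R, is_derive r 1 y (r * y1 r)) ->
  (forall r : R, is_derive r 1 y1 (r * y2 r)) ->
  (forall r : R, 0 < r < 1 ->
     r ^+ 2 * (1 - r ^+ 2) * y2 r +
       ((beta + 2) * (1 - r ^+ 2) - 2 * r ^+ 2) * y1 r
     = (2 * beta + A * r ^+ 2 - chi) * y r) ->
  y 0 = 0 -> forall r : R, 0 <= r <= 1 -> y r = 0.
Proof.
move=> beta0 A0 dy dy1 ode y0.
have cy : continuous y by move=> r; exact: is_derive_continuous (dy r).
(* The coefficient [1 - r^2] of [y2] degenerates at 1, so the estimate is made on [[0, b]] with
   [b < 1]; the endpoint follows by continuity. *)
suff H (b : R) : 0 <= b < 1 -> y b = 0.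
  move=> r /andP[r0]; rewrite le_eqVlt => /predU1P[->|r1]; last by apply: H; rewrite r0.
  have c1 : y x @[x --> 1^'-] --> y 1 by apply: cvg_at_left_filter; exact: cy.
  have c2 : y x @[x --> 1^'-] --> (0 : R).
    apply: (@cvg_trans _ ((fun _ : R => 0 : R) @ 1^'-)); last exact: cvg_cst.
    apply: near_eq_cvg; near=> x; rewrite /= H//.
    apply/andP; split; last by near: x; exact: nbhs_left_lt.
    by apply: ltW; near: x; apply: nbhs_left_gt.
  exact: cvg_unique c1 c2.
move=> /andP[b0 b1].
pose EE (r : R) := y r ^+ 2 + r ^+ 2 * y1 r ^+ 2.
pose dE (r : R) := 2 * y r * (r * y1 r) + (2 * r * y1 r ^+ 2 +
  r ^+ 2 * (2 * y1 r * (r * y2 r))).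
have EE' (r : R) : is_derive r 1 EE (dE r).
  have h1 := dy r; have h2 := dy1 r.
  by apply: is_derive_eq; rewrite /dE /GRing.scale /=; ring.
pose d0 := 1 - b ^+ 2; have d00 : 0 < d0 by rewrite subr_gt0 exprn_ilt1.
pose q0 := 2 * beta + A + `|chi|.
have q00 : 0 <= q0 by rewrite /q0 !addr_ge0// mulr_ge0.
(* In [d * dE] the terms are at most [d], [q0] and [4] times the energy, the last one being
   nonpositive; dividing by [d >= d0] gives this rate for Grönwall's argument. *)
pose K := 1 + (q0 + 4) / d0.
have bound (r : R) : 0 < r < b -> dE r <= K * EE r.
  move=> /andP[r0 rb]; have r1 : r < 1 by exact: lt_trans rb b1.
  have r2b : r ^+ 2 <= b ^+ 2 by rewrite ler_pXn2r ?nnegrE// ltW.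
  have r21 : r ^+ 2 <= 1 by apply: le_trans r2b _; rewrite exprn_ile1// ltW.
  pose d := 1 - r ^+ 2; pose q := 2 * beta + A * r ^+ 2 - chi; pose v := r * y1 r.
  have d0d : d0 <= d by rewrite lerD2l lerN2.
  have d_gt0 : 0 < d by exact: lt_le_trans d0d.
  have qq0 : `|q| <= q0.
    have Ar0 : 0 <= A * r ^+ 2 by rewrite mulr_ge0// sqr_ge0.
    have br0 : 0 <= 2 * beta by rewrite mulr_ge0.
    apply: le_trans (ler_normB _ _) _; rewrite lerD2r ger0_norm ?addr_ge0//.
    by rewrite lerD2l ler_piMr.
  have E0 : 0 <= EE r by apply: addr_ge0; [|apply: mulr_ge0]; exact: sqr_ge0.
  have EEv : EE r = y r ^+ 2 + v ^+ 2 by rewrite /EE /v; ring.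
  rewrite -(ler_pM2l d_gt0).
  have -> : d * dE r = 2 * d * (y r * v) + 2 * q * (y r * v) + 4 * r * v ^+ 2 -
      2 * (beta + 1) * d * r * y1 r ^+ 2.
    rewrite (_ : d * dE r = 2 * d * (y r * v) + 2 * d * r * y1 r ^+ 2 +
       2 * v * (r ^+ 2 * d * y2 r)); last by rewrite /dE /v; ring.
    have -> : r ^+ 2 * d * y2 r = q * y r - ((beta + 2) * d - 2 * r ^+ 2) * y1 r.
      by rewrite -ode ?r0//; rewrite /d; ring.
    by rewrite /v; ring.
  have yv : `|2 * (y r * v)| <= EE r.
    rewrite EEv ler_norml; apply/andP; split.
      by have := sqr_ge0 (y r + v); rewrite sqrrD; lra.
    by have := sqr_ge0 (y r - v); rewrite sqrrB; lra.
  have t1 : 2 * d * (y r * v) <= d * EE r.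
    rewrite mulrAC mulrC ler_pM2l//; apply: le_trans yv; apply: le_trans (ler_norm _).
    by rewrite mulrC.
  have t2 : 2 * q * (y r * v) <= q0 * EE r.
    rewrite mulrAC mulrC; apply: le_trans (ler_norm _) _; rewrite normrM.
    by apply: ler_pM.
  have t3 : 4 * r * v ^+ 2 <= 4 * EE r.
    rewrite -mulrA ler_pM2l// EEv; apply: (@le_trans _ _ (v ^+ 2)).
      by rewrite ler_piMl ?sqr_ge0// ltW.
    by rewrite lerDr sqr_ge0.
  have t4 : 0 <= 2 * (beta + 1) * d * r * y1 r ^+ 2.
    apply: mulr_ge0; last exact: sqr_ge0.
    apply: mulr_ge0; last exact: ltW.
    apply: mulr_ge0; last exact: ltW.
    by rewrite mulr_ge0// addr_ge0.
  have t5 : d * EE r + (q0 + 4) * EE r <= d * (K * EE r).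
    rewrite (_ : d * (K * EE r) = d * EE r + d / d0 * ((q0 + 4) * EE r)); last first.
      by rewrite /K; field; rewrite gt_eqF.
    have q4 : 0 <= q0 + 4 by exact: addr_ge0.
    have qE : 0 <= (q0 + 4) * EE r by exact: mulr_ge0.
    by rewrite lerD2l (ler_peMl qE)// ler_pdivlMr// mul1r.
  by lra.
pose G (r : R) := EE r * expR (- (K * r)).
have dG (r : R) : is_derive r 1 G ((dE r - K * EE r) * expR (- (K * r))).
  have h1 := EE' r.
  by apply: is_derive_eq; rewrite /GRing.scale /=; ring.
have Gb : G b <= G 0.
  apply: (@ler0_derive1_nincr R G 0 b) => //.
  - move=> x; rewrite in_itv/= => /bound xb.
    rewrite derive1E (@derive_val _ _ _ _ _ _ _ (dG x)).
    by rewrite mulr_le0_ge0 ?expR_ge0// subr_le0.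
  - apply: continuous_subspaceT => x; exact: is_derive_continuous (dG x).
have : G b <= 0.
  by apply: le_trans Gb _; rewrite /G /EE y0 !expr0n /= mul0r addr0 mul0r.
rewrite /G pmulr_lle0 ?expR_gt0// /EE => Eb.
apply/eqP; rewrite -sqrf_eq0 eq_le sqr_ge0 andbT.
by apply: le_trans Eb; rewrite lerDl mulr_ge0// sqr_ge0.
Unshelve. all: by end_near. Qed.

Context (K : nat -> R -> R) (cK : forall n, continuous (K n)).
Context (dK : forall n (s : R), 0 <= s <= 1 -> is_derive s 1 (K n.+1) (K n s / 2)).
Context (K1 : forall n, K n.+2 1 = 0).
Context (beta chi A : R).

(** With [K 0 = 2 Q'], [K 1 = Q] and [beta = m + 2k], the Dirac derivative of [x Q(|x|^2) Y],
    multiplied by [1 - |x|^2], is minus this function at [|x|^2] times [Y]. *)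
Definition radial_flux (s : R) : R := (1 - s) * (s * K 0 s + beta * K 1 s).

Context (dflux : forall s : R, 0 < s < 1 ->
  is_derive s 1 radial_flux ((A * s - chi) / 2 * K 1 s)).

(* For [n = 0] the radial equation [radial_flux' = (A s - chi) / 2 * K 1], integrated from 1;
   for [n > 0] the result of integrating it [n] more times, by parts in each term. *)
Definition flux_iter (n : nat) (s : R) : R :=
  s * ((1 - s) * K n s + 2 * (n%:R - 1) * K n.+1 s)
  + (beta - 2 * n%:R) * ((1 - s) * K n.+1 s + 2 * n%:R * K n.+2 s)
  + 2 * s * K n.+1 s - 4 * n%:R * K n.+2 s
  - A * (s * K n.+2 s - 2 * (n%:R + 1) * K n.+3 s) + chi * K n.+2 s.

Let cflux n : continuous (flux_iter n).
Proof.
have cKn k s : {for s, continuous (K k)} by exact: cK.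
move=> s; rewrite /flux_iter.
have h0 := cKn n s; have h1 := cKn n.+1 s; have h2 := cKn n.+2 s; have h3 := cKn n.+3 s.
have cD (f g : R -> R) : {for s, continuous f} -> {for s, continuous g} ->
  {for s, continuous (fun x => f x + g x)} by move=> cf cg; exact: continuousD.
have cB (f g : R -> R) : {for s, continuous f} -> {for s, continuous g} ->
  {for s, continuous (fun x => f x - g x)} by move=> cf cg; exact: continuousB.
have cM (f g : R -> R) : {for s, continuous f} -> {for s, continuous g} ->
  {for s, continuous (fun x => f x * g x)} by move=> cf cg; exact: continuousM.
have cI : {for s, continuous (fun x : R => x)} by exact: cvg_id.
have cC (a : R) : {for s, continuous (fun _ : R => a)} by exact: cvg_cst.
have lin a b : {for s, continuous (fun x : R => (1 - x) * K a x + b * K a.+1 x)}.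
  by apply: (cD); apply: (cM); [apply: (cB); [exact: cC|exact: cI]|exact: cKn|exact: cC|exact: cKn].
apply: (cD); last by apply: (cM); [exact: cC|exact: cKn].
apply: (cB); last first.
  apply: (cM); first exact: cC.
  by apply: (cB); apply: (cM); [exact: cI|exact: cKn|exact: cC|exact: cKn].
apply: (cB); last by apply: (cM); [exact: cC|exact: cKn].
apply: (cD); last by apply: (cM); [apply: (cM); [exact: cC|exact: cI]|exact: cKn].
by apply: (cD); apply: (cM); [exact: cI|exact: lin|exact: cC|exact: lin].
Qed.

(* [flux_iter n.+1] vanishes at 1 and has derivative [flux_iter n / 2]. *)
Lemma flux_iter_eq0 n s : 0 <= s <= 1 -> flux_iter n s = 0.
Proof.
elim: n s => [|n IH] s /andP[s0 s1].
  transitivity (flux_iter 0 1); last first.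
    by rewrite /flux_iter !K1; ring.
  apply: (@derive0_constant (flux_iter 0) s 1 s1) => [t _|t /andP[st t1]]; first exact: cflux.
  have t01 : 0 <= t <= 1 by rewrite (le_trans s0 (ltW st)) ltW.
  have d1 := @dflux t; have d2 := @dK 1 t t01; have d3 := @dK 2 t t01.
  have d1' : is_derive t 1 radial_flux ((A * t - chi) / 2 * K 1 t).
    by apply: d1; rewrite (le_lt_trans s0 st).
  rewrite (_ : flux_iter 0 = (fun t => radial_flux t -
      A * (t * K 2 t - 2 * K 3 t) + chi * K 2 t)); last first.
    by apply/funext => x; rewrite /flux_iter /radial_flux; ring.
  by apply: is_derive_eq; rewrite /GRing.scale /=; field.
transitivity (flux_iter n.+1 1); last first.
  by rewrite /flux_iter !K1; ring.
apply: (@derive0_constant (flux_iter n.+1) s 1 s1) => [t _|t /andP[st t1]]; first exact: cflux.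
have t01 : 0 <= t <= 1 by rewrite (le_trans s0 (ltW st)) ltW.
have d1 := @dK n t t01; have d2 := @dK n.+1 t t01; have d3 := @dK n.+2 t t01.
have d4 := @dK n.+3 t t01.
rewrite -[0](mul0r 2^-1) -(IH t t01).
by apply: is_derive_eq; rewrite /flux_iter /GRing.scale /=; field.
Qed.

End RadialODE.

(** * The cosine transform of the integrated radial equation *)

Section FluxTransform.
Context (R : realType) (m : nat).
Context (K : nat -> R -> R) (cK : forall n, continuous (K n)).
Context (dK : forall n (s : R), 0 <= s <= 1 -> is_derive s 1 (K n.+1) (K n s / 2)).
Context (K1 : forall n, K n.+2 1 = 0).

(** These combinations are stable under J: on [0,1] it sends [Fn n c] to [Fn n.+1 (c + 2)], the 2
    compensating the derivative of [1 - s]. *)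
Let Fn n c (s : R) : R := (1 - s) * K n s + c * K n.+1 s.

Let cFn n c : continuous (Fn n c).
Proof.
have cD (f g : R -> R) : continuous f -> continuous g ->
  continuous (fun x => f x + g x) by move=> cf cg s; apply: continuousD; [exact: cf|exact: cg].
have cM (f g : R -> R) : continuous f -> continuous g ->
  continuous (fun x => f x * g x) by move=> cf cg s; apply: continuousM; [exact: cf|exact: cg].
have cC (b : R) : continuous (fun _ : R => b) by move=> s; exact: cvg_cst.
have c1 : continuous (fun s : R => 1 - s).
  by move=> s; apply: continuousB; [exact: cvg_cst|exact: cvg_id].
apply: (cD); apply: (cM); [exact: c1|exact: cK|exact: cC|
  exact: cK].
Qed.

Let dFn n c (s : R) : 0 <= s <= 1 -> is_derive s 1 (Fn n.+1 c) (Fn n (c - 2) s / 2).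
Proof.
move=> s01; have d1 := @dK n s s01.
have d2 := @dK n.+1 s s01.
by apply: is_derive_eq; rewrite /Fn /GRing.scale /=; field.
Qed.

Let Fn1 n c : Fn n.+1 c 1 = 0.
Proof. by rewrite /Fn K1; ring. Qed.

Context (k : nat) (A chi : R).
Let beta : R := m%:R + 2 * k%:R.
Context (flux0 : forall s : R, 0 <= s <= 1 -> flux_iter K beta chi A k s = 0).
Context (phi : R) (z : 'rV[R]_m).
Local Notation W n := (cosint1 phi (K n) z).

Let sqK n : cosint1 phi (fun s => s * K n.+1 s) z =
  - (m%:R * W n.+2 + dotv z z * W n.+3).
Proof.
rewrite (cosint1_sqnorm_parts (@cK n.+1)
  (@cK n.+2) (@dK n.+1) (@K1 n)).
rewrite (sinint_lin_parts (@cK n.+2)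
  (@cK n.+3) (@dK n.+2) (@K1 n.+1)).
move: (W n.+2) (W n.+3) => w2 w3; ring.
Qed.

(* The transform of the vanishing function [flux_iter k], all powers of [|y|^2] being removed by
   integration by parts. *)
Lemma cosint1_recurrence :
  (dotv z z + 2 * beta - chi) * W k.+2 + dotv z z * (beta + 4) * W k.+3
    + dotv z z ^+ 2 * W k.+4
  = A * ((beta + 2) * W k.+3 + dotv z z * W k.+4).
Proof.
have z0 : cosint1 phi (flux_iter K beta chi A k) z = 0.
  rewrite /cosint1 /cosint /Rn_integral.
  transitivity (Rn_integral (eball 1) (fun _ : 'rV[R]_m => 0)); last exact: ballint0.
  apply: eq_Rintegral => t /set_mem; rewrite /preimage /= eballE// expr1n => t1.
  by rewrite flux0 ?dotvv_ge0// mulr0 mul0r.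
have cI n : continuous (fun s : R => s * K n s).
  by move=> s; apply: continuousM; [exact: cvg_id|exact: cK].
have cS n c : continuous (fun s : R => s * Fn n c s).
  by move=> s; apply: continuousM; [exact: cvg_id|exact: cFn].
have cD (f g : R -> R) : continuous f -> continuous g ->
  continuous (fun x => f x + g x) by move=> cf cg s; apply: continuousD; [exact: cf|exact: cg].
have cZ b (g : R -> R) : continuous g ->
  continuous (fun x => b * g x).
  by move=> cg s; apply: continuousM; [exact: cvg_cst|exact: cg].
have D (f g : R -> R) : continuous f -> continuous g -> cosint1 phi (fun s => f s + g s) z =
  cosint1 phi f z + cosint1 phi g z by exact: cosint1D.
have Z (b : R) (f : R -> R) : continuous f ->
    cosint1 phi (fun s => b * f s) z = b * cosint1 phi f z.
  by exact: cosint1Z.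
(* At the index [k] the coefficient [beta - 2k] equals [m]. The term [m * Fn k.+1] then cancels the
   one that integration by parts produces from [s * Fn k], which leaves a relation among three
   consecutive transforms. *)
have E : flux_iter K beta chi A k = fun s => s * Fn k (2 * k%:R - 2) s +
    (m%:R * Fn k.+1 (2 * k%:R) s + (2 * (s * K k.+1 s) +
    ((chi - 4 * k%:R) * K k.+2 s + (- A * (s * K k.+2 s) +
     2 * A * (k%:R + 1) * K k.+3 s)))).
  by apply/funext => s; rewrite /flux_iter /Fn /beta; ring.
have c1 := cS k (2 * k%:R - 2). have c2 := cZ m%:R _ (@cFn k.+1 (2 * k%:R)).
have c3 := cZ 2 _ (@cI k.+1). have c4 := cZ (chi - 4 * k%:R) _ (@cK k.+2).
have c5 := cZ (- A) _ (@cI k.+2).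
have c6 := cZ (2 * A * (k%:R + 1)) _ (@cK k.+3).
have c56 := cD _ _ c5 c6. have c456 := cD _ _ c4 c56.
have c36 := cD _ _ c3 c456. have c26 := cD _ _ c2 c36.
move: z0; rewrite E (D _ _ c1 c26) (D _ _ c2 c36) (D _ _ c3 c456) (D _ _ c4 c56) (D _ _ c5 c6).
rewrite (Z _ _ (@cFn k.+1 (2 * k%:R))) (Z _ _ (@cI k.+1)) (Z _ _ (@cK k.+2)).
rewrite (Z _ _ (@cI k.+2)) (Z _ _ (@cK k.+3)) !sqK.
rewrite (cosint1_sqnorm_parts (@cFn k (2 * k%:R - 2)) (@cFn k.+1 (2 * k%:R))
  (@dFn k (2 * k%:R)) (@Fn1 k (2 * k%:R))).
have dG : forall s : R, 0 <= s <= 1 ->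
    is_derive s 1 (Fn k.+2 (2 * k%:R + 2)) (Fn k.+1 (2 * k%:R) s / 2).
  by move=> s s01; have := @dFn k.+1 (2 * k%:R + 2) s s01; rewrite addrK.
rewrite (sinint_lin_parts (@cFn k.+1 (2 * k%:R)) (@cFn k.+2 (2 * k%:R + 2)) dG
  (@Fn1 k.+1 (2 * k%:R + 2))).
have -> : cosint1 phi (Fn k.+2 (2 * k%:R + 2)) z = W k.+2 + (-1 *
   cosint1 phi (fun s => s * K k.+2 s) z + (2 * k%:R + 2) * W k.+3).
  have c7 := cZ (-1) _ (@cI k.+2). have c8 := cZ (2 * k%:R + 2) _ (@cK k.+3).
  rewrite -(Z _ _ (@cI k.+2)) -(Z _ _ (@cK k.+3)) -(D _ _ c7 c8).
  rewrite -(D _ _ (@cK k.+2) (cD _ _ c7 c8)); congr (cosint1 _ _ _).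
  by apply/funext => s; rewrite /Fn; ring.
rewrite sqK /beta.
move: (W k.+2) (W k.+3) (W k.+4) (cosint1 _ _ _) => w2 w3 w4 g.
move=> H; apply/eqP; rewrite -subr_eq0; apply/eqP.
by rewrite -[RHS]oppr0 -H; ring.
Qed.

End FluxTransform.

(** * Proportionality of the radial profile and its transform *)

Section RadialEigenfunction.
Context (R : realType) (m : nat).
Context (Q Q1 Q2 : R -> R).
Context (dQ : forall s : R, is_derive s 1 Q (Q1 s)).
Context (dQ1 : forall s : R, is_derive s 1 Q1 (Q2 s)).

(* [2 Q', Q, J Q, J (J Q), ...]: each term has half the preceding one as derivative on [0,1]. *)
Definition primitives (n : nat) : R -> R :=
  if n is n'.+1 then iter n' (@half_primitive R) Q else fun s => 2 * Q1 s.

Local Notation K := primitives.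

Let cQ : continuous Q.
Proof. by move=> s; exact: is_derive_continuous (dQ s). Qed.

Let dK0 (s : R) : is_derive s 1 (K 0) (2 * Q2 s).
Proof.
rewrite -[_ * _]addr0 -[X in _ + X](mulr0 (Q1 s)).
exact: is_derive_mul.
Qed.

Lemma continuous_primitives n : continuous (K n).
Proof.
case: n => [|n] s; first exact: is_derive_continuous (dK0 s).
exact: continuous_iter_half_primitive.
Qed.

Let dK1 (s : R) : is_derive s 1 (K 1) (K 0 s / 2).
Proof. by rewrite /= mulrC mulKf//; exact: dQ. Qed.

Lemma is_derive_primitives n (s : R) : 0 <= s <= 1 ->
  is_derive s 1 (K n.+1) (K n s / 2).
Proof.
case: n => [|n] s01; first exact: dK1.
exact: is_derive_iter_half_primitive.
Qed.

Lemma primitives_at1 n : K n.+2 1 = 0.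
Proof. exact: half_primitive1. Qed.

Context (k : nat) (A chi : R).
Let beta : R := m%:R + 2 * k%:R.
Context (ode : forall s : R, 0 < s < 1 ->
  (1 - s) * (2 * s * Q2 s + (2 + beta) * Q1 s) - (2 * s * Q1 s + beta * Q s)
  = (A * s - chi) / 2 * Q s).

Let flux0 n (s : R) : 0 <= s <= 1 -> flux_iter K beta chi A n s = 0.
Proof.
apply: flux_iter_eq0.
- exact: continuous_primitives.
- exact: is_derive_primitives.
- exact: primitives_at1.
move=> {}s s01; rewrite -ode//.
have d0 := dK0 s; have d1 := dK1 s.
by apply: is_derive_eq; rewrite /GRing.scale /=; field.
Qed.

Context (A0 : 0 <= A).

Let beta0 : 0 <= beta. Proof. by rewrite addr_ge0 ?mulr_ge0. Qed.

Let d_sqr (f g : R -> R) (r : R) : (forall s : R, is_derive s 1 f (g s)) ->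
  is_derive r 1 (fun x => f (x ^+ 2)) (r * (2 * g (r ^+ 2))).
Proof.
move=> df.
have -> : r * (2 * g (r ^+ 2)) = g (r ^+ 2) * (r * 1 + r * 1) by ring.
by apply: (@is_derive1_comp _ f (fun x : R => x ^+ 2)).
Qed.

Let ode_sqr (r : R) : 0 < r < 1 ->
  r ^+ 2 * (1 - r ^+ 2) * (4 * Q2 (r ^+ 2)) +
    ((beta + 2) * (1 - r ^+ 2) - 2 * r ^+ 2) * (2 * Q1 (r ^+ 2))
  = (2 * beta + A * r ^+ 2 - chi) * Q (r ^+ 2).
Proof.
move=> /andP[r0 r1].
have r2 : 0 < r ^+ 2 < 1 by rewrite exprn_gt0//= exprn_ilt1// ltW.
have := ode r2; set s := r ^+ 2 => H.
have -> : (2 * beta + A * s - chi) * Q s = 2 * ((A * s - chi) / 2 * Q s)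
  + 2 * beta * Q s by field.
by rewrite -H; ring.
Qed.

(** Uniqueness applied to [r |-> Q(r^2)]. It ensures [Q 0 != 0] for an eigenfunction, so that the
    eigenvalue can be obtained by division. *)
Lemma radial_profile_eq0 : Q 0 = 0 -> forall t, 0 <= t <= 1 -> Q t = 0.
Proof.
move=> Q0 t /andP[t0 t1].
have H := @radial_ode_unique R beta A chi (fun r => Q (r ^+ 2))
  (fun r => 2 * Q1 (r ^+ 2)) (fun r => 4 * Q2 (r ^+ 2)) beta0 A0.
have -> : t = Num.sqrt t ^+ 2 by rewrite sqr_sqrtr.
apply: H => //.
- by move=> r; exact: d_sqr.
- move=> r; have -> : r * (4 * Q2 (r ^+ 2)) = 2 * (r * (2 * Q2 (r ^+ 2))) by ring.
  exact: is_deriveZ (d_sqr r dQ1).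
- by rewrite expr0n.
- by rewrite sqrtr_ge0 -sqrtr1 ler_wsqrtr.
Qed.

Context (a : R) (Aa : A = a ^+ 2).

Lemma radial_profile phi (x : 'rV[R]_m) : dotv x x <= 1 ->
  Q 0 * cosint1 phi (K k.+2) (a *: x) =
  cosint1 phi (K k.+2) (0 : 'rV[R]_m) * Q (dotv x x).
Proof.
move=> x1; have [->|x0] := eqVneq x 0.
  rewrite scaler0 (_ : dotv 0 0 = 0) 1?mulrC//.
  by rewrite /dotv big1// => j _; rewrite mxE mul0r.
pose r := enorm x; pose w := r^-1 *: x.
have r2 : r ^+ 2 = dotv x x by exact: sqr_enorm.
have r0 : 0 < r.
  rewrite lt_neqAle enorm_ge0 andbT eq_sym; apply: contra x0 => /eqP r0.
  apply/eqP/rowP => j; rewrite mxE; apply/eqP; rewrite -sqrf_eq0 eq_le sqr_ge0 andbT.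
  by apply: le_trans (coord_le_dotv x j) _; rewrite -r2 r0 expr0n.
have xw : x = r *: w by rewrite scalerA divff ?scale1r// gt_eqF.
have w1 : dotv w w = 1.
  rewrite dotvZ dotvC dotvZ -r2 mulrA -expr2 exprVn mulVf//.
  by rewrite expf_neq0// gt_eqF.
rewrite -r2 {1}xw scalerA; clear xw x0.
have r1 : r <= 1 by rewrite -(@ler_pXn2r _ 2)// ?nnegrE ?(ltW r0)// r2 expr1n.
move: {x x1 r2}r w w1 r0 r1 => r w w1 r0 r1.
pose W n (s : R) := cosint1 phi (K n) (s *: w).
have dW n (s : R) : is_derive s 1 (fun s => W n.+1 (a * s)) (s * (A * W n.+2 (a * s))).
  have d1 := is_derive_cosint1_iter (fun n => @continuous_primitives n.+1)
    (fun n => @is_derive_primitives n.+1) primitives_at1 n phi (a * s) w1.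
  have -> : s * (A * W n.+2 (a * s)) = a * s * W n.+2 (a * s) * a.
    by rewrite Aa; ring.
  apply: (@is_derive1_comp _ (W n.+1) (fun s => a * s)).
  by apply: is_derive_eq; rewrite /GRing.scale /=; ring.
pose c0 := cosint1 phi (K k.+2) (0 : 'rV[R]_m).
(* This cross-multiplied difference vanishes at 0 by construction. [y1] and [y2] arise from it by
   applying [s^-1 d/ds], which each time brings out [a^2 = A] from the transform and 2 from the
   profile. *)
pose y s := Q 0 * W k.+2 (a * s) - c0 * Q (s ^+ 2).
pose y1 s := Q 0 * (A * W k.+3 (a * s)) - c0 * (2 * Q1 (s ^+ 2)).
pose y2 s := Q 0 * (A ^+ 2 * W k.+4 (a * s)) - c0 * (4 * Q2 (s ^+ 2)).
have : y r = 0.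
  apply: (@radial_ode_unique R beta A chi y y1 y2) => //.
  - move=> s; have d1 := dW k.+1 s; have d2 := d_sqr s dQ.
    by apply: is_derive_eq; rewrite /y1 /GRing.scale /=; ring.
  - move=> s; have d1 := dW k.+2 s; have d2 := d_sqr s dQ1.
    by apply: is_derive_eq; rewrite /y2 /GRing.scale /=; ring.
  - move=> s s01.
    transitivity (Q 0 * ((2 * beta + A * s ^+ 2 - chi) * W k.+2 (a * s)) -
      c0 * ((2 * beta + A * s ^+ 2 - chi) * Q (s ^+ 2))); last by rewrite /y; ring.
    rewrite -(ode_sqr s01).
    have z2 : dotv ((a * s) *: w) ((a * s) *: w) = A * s ^+ 2.
      by rewrite dotvZ dotvC dotvZ w1 Aa; ring.
    have H : (A * s ^+ 2 + 2 * beta - chi) * W k.+2 (a * s) +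
        A * s ^+ 2 * (beta + 4) * W k.+3 (a * s) + (A * s ^+ 2) ^+ 2 * W k.+4 (a * s) =
        A * ((beta + 2) * W k.+3 (a * s) + A * s ^+ 2 * W k.+4 (a * s)).
      rewrite -z2; exact: (cosint1_recurrence continuous_primitives
        is_derive_primitives primitives_at1 (@flux0 k)).
    rewrite /y1 /y2; move: (W k.+2 _) (W k.+3 _) (W k.+4 _) H => w2 w3 w4 H.
    have E : (2 * beta + A * s ^+ 2 - chi) * w2 = A * ((beta + 2) * w3 +
        A * s ^+ 2 * w4) - A * s ^+ 2 * (beta + 4) * w3 - (A * s ^+ 2) ^+ 2 * w4.
      by rewrite -H; ring.
    by rewrite E; ring.
  - by rewrite /y expr0n mulr0 /W scale0r /c0 mulrC subrr.
  - by rewrite (ltW r0).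
by move=> /eqP; rewrite subr_eq0 => /eqP.
Qed.

End RadialEigenfunction.

(** * Clifford-valued polynomials and the Dirac operator *)

Section CliffordCalculus.
Context (R : realType) (m : nat).
Local Notation E j := (delta_mx 0 j : 'rV[R]_m).
Implicit Types (f g : 'rV[R]_m -> clifford R m) (x y v : 'rV[R]_m).

Lemma hpolyM (f g : 'rV[R]_m -> R) a b : hpoly a f -> hpoly b g ->
  hpoly (a + b) (fun x => f x * g x).
Proof.
elim: a f => [|a IH] f; first by move=> [c ->]; exact: hpolyZ.
move=> [f' hf ->] hg; exists (fun j x => f' j x * g x) => [j|].
  exact: (IH _ (hf j) hg).
by apply/funext => x; rewrite mulr_suml; apply: eq_bigr => j _; rewrite mulrA.
Qed.

Lemma hpoly_monomial (al : 'I_m -> nat) :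
  hpoly (\sum_j al j) (fun x : 'rV[R]_m => \prod_j x 0 j ^+ al j).
Proof.
have hX j n : hpoly n (fun x : 'rV[R]_m => x 0 j ^+ n).
  elim: n => [|n IH]; first by exists 1.
  by under eq_fun do rewrite exprS; exact: hpoly_coordM.
elim: (index_enum _) => [|j s IH].
  by rewrite big_nil; exists 1; apply/funext => x; rewrite big_nil.
rewrite big_cons (_ : (fun _ => _) = (fun x : 'rV[R]_m => x 0 j ^+ al j *
  \prod_(i <- s) x 0 i ^+ al i)); first exact: hpolyM.
by apply/funext => x; rewrite big_cons.
Qed.

Definition cl_hpoly k f := forall A, hpoly k (fun x => cl_coef (f x) A).

Lemma cl_coef_sum (I : Type) (s : seq I) (P : pred I) (F : I -> clifford R m) A :
  cl_coef (\sum_(i <- s | P i) F i) A = \sum_(i <- s | P i) cl_coef (F i) A.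
Proof.
by apply: (big_morph (fun z => cl_coef z A)) => [z w|]; rewrite ?cl_coefD ?cl_coef0.
Qed.

Lemma homogeneous_poly_hpoly k f : homogeneous_poly k f -> cl_hpoly k f.
Proof.
move=> [a fE] A.
rewrite (_ : (fun _ => _) = (fun x => \sum_(alpha : {ffun 'I_m -> 'I_k.+1} |
    (\sum_j alpha j == k)%N) cl_coef (a alpha) A * \prod_j x 0 j ^+ alpha j)).
  under eq_fun do rewrite big_mkcond.
  apply: hpoly_sum => al; case: eqP => [alk|_]; last exact: hpoly0.
  by apply: hpolyZ; have := hpoly_monomial (fun j => al j); rewrite alk.
apply/funext => x; rewrite fE cl_coef_sum; apply: eq_bigr => al _.
by rewrite cl_coefZ mulrC.
Qed.

Definition cl_derive v f x (d : clifford R m) :=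
  forall A, is_derive x v (fun y => cl_coef (f y) A) (cl_coef d A).

Lemma cl_coef_partial j f x A :
  cl_coef (cl_partial j f x) A = partial j (fun y => cl_coef (f y) A) x.
Proof. exact: cl_mkE. Qed.

Lemma cl_coef_partialF j f A : (fun x => cl_coef (cl_partial j f x) A) =
  partial j (fun y => cl_coef (f y) A).
Proof. by apply/funext => x; exact: cl_coef_partial. Qed.

Lemma cl_partialE j f x d : cl_derive (E j) f x d -> cl_partial j f x = d.
Proof.
by move=> df; apply: cl_ext => A; rewrite cl_coef_partial; have [] := df A.
Qed.

Lemma cl_hpoly_derive k f j x : cl_hpoly k f ->
  cl_derive (E j) f x (cl_partial j f x).
Proof.
by move=> hf A; rewrite cl_coef_partial; exact: hpoly_is_derive (hf A).
Qed.

Lemma cl_hpoly_partial k f j : cl_hpoly k f -> cl_hpoly k.-1 (cl_partial j f).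
Proof.
by move=> hf A; rewrite cl_coef_partialF; exact: hpoly_derive (hf A).
Qed.

Lemma cl_derive_mull v f x d (z : clifford R m) : cl_derive v f x d ->
  cl_derive v (fun y => z * f y) x (z * d).
Proof.
move=> df A; rewrite cl_coefM; under eq_fun do rewrite cl_coefM.
apply: is_derive_bigsum => B.
exact: (is_deriveZ (cl_sign R B (setsymd B A))
  (is_deriveZ (cl_coef z B) (df (setsymd B A)))).
Qed.

Lemma cl_derive_scale v (s : 'rV[R]_m -> R) f x (ds : R) d :
  is_derive x v s ds -> cl_derive v f x d ->
  cl_derive v (fun y => s y *: f y) x (s x *: d + ds *: f x).
Proof.
move=> hs hf A; under eq_fun do rewrite cl_coefZ.
rewrite cl_coefD !cl_coefZ [ds * _]mulrC.
by apply: is_derive_mul => //; exact: hf.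
Qed.

Lemma cl_derive_sum (I : Type) (s : seq I) v (F : I -> 'rV[R]_m -> clifford R m) x
    (d : I -> clifford R m) : (forall i, cl_derive v (F i) x (d i)) ->
  cl_derive v (fun y => \sum_(i <- s) F i y) x (\sum_(i <- s) d i).
Proof.
move=> hF A; rewrite cl_coef_sum; under eq_fun do rewrite cl_coef_sum.
by apply: is_derive_bigsum => i; exact: hF.
Qed.

Lemma cl_vecE x f y : cl_vec x * f y = \sum_j x 0 j *: (cl_gen R j * f y).
Proof. by rewrite /cl_vec mulr_suml; apply: eq_bigr => j _; rewrite scalerAl. Qed.

Lemma cl_vec_delta j : cl_vec (E j) = cl_gen R j.
Proof.
rewrite /cl_vec (bigD1 j)//= mxE !eqxx scale1r big1 ?addr0// => i ij.
by rewrite mxE (negPf ij) andbF scale0r.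
Qed.

Lemma cl_gen_vec j x :
  cl_gen R j * cl_vec x = - (cl_vec x * cl_gen R j) - (2 * x 0 j)%:A.
Proof.
rewrite /cl_vec mulr_suml mulr_sumr (bigD1 j)//= [in RHS](bigD1 j)//=.
rewrite -scalerAr -scalerAl cl_gen_sq opprD addrAC; congr (_ + _).
  by rewrite scalerN opprK -scalerBl -scaleNr; congr (_ *: _); ring.
rewrite -sumrN; apply: eq_bigr => i ij.
by rewrite -scalerAr -scalerAl cl_gen_anticomm ?scalerN// eq_sym.
Qed.

(** Moving one factor past the other by [cl_gen_vec] gives [x^2 = - x^2 - 2 |x|^2], and 2 is
    invertible. *)
Lemma cl_vec_sq x : cl_vec x * cl_vec x = - (dotv x x)%:A.
Proof.
have H : cl_vec x * cl_vec x = - (cl_vec x * cl_vec x) - (2 * dotv x x)%:A.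
  transitivity (\sum_j (x 0 j *: (- (cl_vec x * cl_gen R j)) -
      (2 * (x 0 j * x 0 j))%:A)).
    rewrite cl_vecE; apply: eq_bigr => j _.
    rewrite cl_gen_vec scalerBr scalerA; congr (_ - _ *: _); ring.
  rewrite sumrB; congr (_ - _); last by rewrite /dotv mulr_sumr scaler_suml.
  rewrite [in RHS]/cl_vec mulr_sumr -sumrN; apply: eq_bigr => j _.
  by rewrite scalerN -scalerAr.
have H2 : 2%:R *: (cl_vec x * cl_vec x) = 2%:R *: (- (dotv x x)%:A).
  by rewrite scalerN scalerA scaler_nat mulr2n {1}H addrAC addNr add0r.
by apply: (scalerI _ H2); rewrite pnatr_eq0.
Qed.

Lemma cl_hpoly_vecM k f : cl_hpoly k f -> cl_hpoly k.+1 (fun x => cl_vec x * f x).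
Proof.
move=> hf A.
exists (fun j x => cl_coef (cl_gen R j * f x) A).
  move=> j; under eq_fun do rewrite cl_coefM.
  by apply: hpoly_sum => B; do 2 apply: hpolyZ; exact: hf.
apply/funext => x; rewrite cl_vecE cl_coef_sum; apply: eq_bigr => j _.
by rewrite cl_coefZ.
Qed.

Lemma dirac_radial (g : R -> R) f x (dg : R) :
  is_derive (dotv x x) 1 g dg ->
  (forall j, cl_derive (E j) f x (cl_partial j f x)) ->
  Defs.dirac (fun y => g (dotv y y) *: f y) x =
  g (dotv x x) *: Defs.dirac f x + (2 * dg) *: (cl_vec x * f x).
Proof.
move=> hg hf; rewrite /Defs.dirac cl_vecE !scaler_sumr -big_split /=.
apply: eq_bigr => j _.
have -> : cl_partial j (fun y => g (dotv y y) *: f y) x =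
    g (dotv x x) *: cl_partial j f x + (dg * (2 * dotv x (E j))) *: f x.
  apply: cl_partialE; apply: cl_derive_scale (hf j).
  exact: (@is_derive_comp1 _ _ g (fun y => dotv y y) x (E j) _ _ hg (is_derive_sqnorm x (E j))).
rewrite mulrDr -[X in X + _]scalerAr -[X in _ + X]scalerAr scalerA dotv_delta.
by congr (_ + _ *: _); ring.
Qed.

(** Differentiating the factor [x] gives [sum_j e_j e_j = -m]. In the remaining terms
    [e_j x = - x e_j - 2 x_j]: the first part contains the Dirac derivative of [f], which is 0, and
    the second is [-2k f] by Euler's identity. *)
Lemma dirac_vec_monogenic k f x : cl_hpoly k f -> (forall x, Defs.dirac f x = 0) ->
  Defs.dirac (fun y => cl_vec y * f y) x = - (m%:R + 2 * k%:R) *: f x.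
Proof.
move=> hf f0.
have dv j : cl_partial j (fun y => cl_vec y * f y) x =
    cl_gen R j * f x + cl_vec x * cl_partial j f x.
  apply: cl_partialE.
  have -> : cl_gen R j * f x + cl_vec x * cl_partial j f x =
      \sum_i (x 0 i *: (cl_gen R i * cl_partial j f x) + (E j) 0 i *: (cl_gen R i * f x)).
    by rewrite big_split /= addrC -!cl_vecE cl_vec_delta.
  rewrite (_ : (fun y => cl_vec y * f y) = fun y => \sum_i y 0 i *: (cl_gen R i * f y)).
    apply: cl_derive_sum => i.
    apply: (@cl_derive_scale _ (fun y : 'rV[R]_m => y 0 i)); first exact: is_derive_coord.
    exact/cl_derive_mull/(cl_hpoly_derive _ _ hf).
  by apply/funext => y; exact: cl_vecE.
have euler : \sum_j x 0 j *: cl_partial j f x = k%:R *: f x.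
  apply: cl_ext => A; rewrite cl_coef_sum cl_coefZ -(hpoly_euler x (hf A)).
  by apply: eq_bigr => j _; rewrite cl_coefZ cl_coef_partial.
rewrite /Defs.dirac; under eq_bigr do rewrite dv mulrDr !mulrA cl_gen_sq cl_gen_vec.
rewrite big_split /= sumr_const card_ord.
have -> : \sum_j (- (cl_vec x * cl_gen R j) - (2 * x 0 j)%:A) * cl_partial j f x =
    - (cl_vec x * Defs.dirac f x) - 2 *: (\sum_j x 0 j *: cl_partial j f x).
  rewrite /Defs.dirac mulr_sumr scaler_sumr -!sumrN -big_split /=.
  apply: eq_bigr => j _; rewrite mulrDl !mulNr mulrA -scalerAl mul1r scalerA.
  by [].
rewrite f0 mulr0 oppr0 add0r euler scalerA mulN1r mulNrn -scaler_nat.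
by rewrite -opprD -scalerDl scaleNr.
Qed.

(** Exchanging [i] and [j] reverses the sign of the off-diagonal terms, so only [e_i^2 = -1]
    contributes. *)
Lemma sum_cl_gen_sym (D : 'I_m -> 'I_m -> clifford R m) :
  (forall i j, D i j = D j i) ->
  \sum_i \sum_j cl_gen R i * (cl_gen R j * D i j) = - \sum_i D i i.
Proof.
move=> Dsym; set S := \sum_i _.
have SS : S = - S - 2 *: \sum_i D i i.
  rewrite {1}/S exchange_big /= scaler_sumr -!sumrN -big_split /=.
  apply: eq_bigr => i _.
  have -> : \sum_j cl_gen R j * (cl_gen R i * D j i) =
      \sum_j (- (cl_gen R i * (cl_gen R j * D i j)) - (if j == i then 2 *: D i i else 0)).
    apply: eq_bigr => j _; rewrite (Dsym j i) !mulrA; case: eqVneq => [->|ji].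
      by rewrite cl_gen_sq mulN1r opprK scaler_nat mulr2n opprD addrA subrr sub0r.
    by rewrite subr0 cl_gen_anticomm// mulNr.
  by rewrite sumrB sumrN -big_mkcond big_pred1_eq.
have S2 : 2%:R *: S = 2%:R *: (- \sum_i D i i).
  by rewrite scalerN scaler_nat mulr2n {1}SS addrAC addNr add0r.
by apply: (scalerI _ S2); rewrite pnatr_eq0.
Qed.

(** Second partial derivatives are symmetric, so [sum_cl_gen_sym] leaves only the coordinatewise
    Laplacian. *)
Lemma dirac_sq k f x : cl_hpoly k f ->
  Defs.dirac (Defs.dirac f) x = - cl_mk (fun A =>
    \sum_j partial j (partial j (fun y => cl_coef (f y) A)) x).
Proof.
move=> hf.
have hp j := cl_hpoly_partial j hf.
have dd i : cl_partial i (Defs.dirac f) x =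
    \sum_j cl_gen R j * cl_partial i (cl_partial j f) x.
  apply: cl_partialE; apply: cl_derive_sum => j.
  exact/cl_derive_mull/(cl_hpoly_derive _ _ (hp j)).
have p2 i j y A : cl_coef (cl_partial i (cl_partial j f) y) A =
    partial i (partial j (fun y => cl_coef (f y) A)) y.
  apply: etrans (cl_coef_partial _ _ _ _) _.
  exact: (congr1 (fun F => partial i F y) (cl_coef_partialF j f A)).
have comm i j : cl_partial i (cl_partial j f) = cl_partial j (cl_partial i f).
  apply/funext => y; apply: cl_ext => A.
  apply: etrans (p2 i j y A) _; apply/esym; apply: etrans (p2 j i y A) _; apply/esym.
  exact: (congr1 (fun F => F y) (hpoly_deriveC i j (hf A))).
transitivity (\sum_i \sum_j cl_gen R i * (cl_gen R j * cl_partial i (cl_partial j f) x)).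
  by apply: eq_bigr => i _; rewrite dd mulr_sumr.
rewrite (@sum_cl_gen_sym (fun i j => cl_partial i (cl_partial j f) x)); last first.
  by move=> i j; rewrite comm.
congr (- _); apply: cl_ext => A.
by rewrite cl_coef_sum cl_mkE; apply: eq_bigr => j _; exact: p2.
Qed.

End CliffordCalculus.

(** * The action of [L_c] on odd functions *)

Section OddFunctions.
Context (R : realType) (m k : nat) (Y : 'rV[R]_m -> clifford R m).
Context (hY : cl_hpoly k Y) (Y0 : forall x, Defs.dirac Y x = 0).
Local Notation beta := (m%:R + 2 * k%:R : R).
Let H (x : 'rV[R]_m) : clifford R m := cl_vec x * Y x.

Let hH : cl_hpoly k.+1 H. Proof. exact: cl_hpoly_vecM. Qed.

(** One Dirac operator turns [x Y] into a constant multiple of [Y] and a second one kills it, while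
    its square is minus the Laplacian. *)
Lemma harmonic_vec_monogenic A : harmonic_fun (fun x => cl_coef (cl_vec x * Y x) A).
Proof.
move=> x.
have := dirac_sq x hH.
(* The constant is presented as a radial function so that [dirac_radial] applies, with derivative
   0. *)
rewrite (_ : Defs.dirac H = fun y => (cst (- beta) (dotv y y)) *: Y y); last first.
  by apply/funext => y; exact: dirac_vec_monogenic hY Y0.
rewrite (@dirac_radial _ _ (cst (- beta)) Y x 0); last first.
  by move=> j; exact: cl_hpoly_derive hY.
rewrite Y0 scaler0 mulr0 scale0r addr0 => /(congr1 (fun a => cl_coef a A)).
by rewrite cl_coefN cl_mkE cl_coef0 => /esym/eqP; rewrite oppr_eq0 => /eqP.
Qed.

Context (Q Q1 Q2 : R -> R).
Context (dQ : forall s : R, is_derive s 1 Q (Q1 s)).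
Context (dQ1 : forall s : R, is_derive s 1 Q1 (Q2 s)).

Lemma odd_functionE y : odd_function Y Q y = Q (dotv y y) *: H y.
Proof. by rewrite /odd_function sqr_enorm -scalerAr. Qed.

Let dirac_odd y : Defs.dirac (odd_function Y Q) y =
  - (beta * Q (dotv y y) + 2 * dotv y y * Q1 (dotv y y)) *: Y y.
Proof.
rewrite (_ : odd_function Y Q = fun y => Q (dotv y y) *: H y); last first.
  by apply/funext => x; exact: odd_functionE.
rewrite (dirac_radial (dQ _)); last by move=> j; exact: cl_hpoly_derive hH.
rewrite (dirac_vec_monogenic y hY Y0) /H mulrA cl_vec_sq -scaleNr -scalerAl mul1r.
by rewrite !scalerA -scalerDl; congr (_ *: _); ring.
Qed.

(** The Dirac operator sends [x Q Y] to a radial multiple of [Y] (by [x^2 = -|x|^2]), and sends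
    [S(|x|^2) Y] back to [2 S' x Y] because [Y] is monogenic. *)
Lemma L_op_odd_function c x : let t := dotv x x in
  L_op c (odd_function Y Q) x =
  (2 * ((beta * Q t + 2 * t * Q1 t)
     - (1 - t) * (2 * t * Q2 t + (2 + beta) * Q1 t))
   + 4 * pi ^+ 2 * c ^+ 2 * t * Q t) *: H x.
Proof.
move=> t; rewrite /L_op odd_functionE sqr_enorm scalerA.
pose S (t : R) := - ((1 - t) * (beta * Q t + 2 * t * Q1 t)).
rewrite (_ : (fun y => _) = fun y => S (dotv y y) *: Y y); last first.
  apply/funext => y; rewrite dirac_odd scalerA sqr_enorm; congr (_ *: _).
  by rewrite /S; ring.
have dS : is_derive t 1 S ((beta * Q t + 2 * t * Q1 t)
     - (1 - t) * (2 * t * Q2 t + (2 + beta) * Q1 t)).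
  have d1 := dQ t; have d2 := dQ1 t.
  by apply: is_derive_eq; rewrite /GRing.scale /=; ring.
rewrite (dirac_radial dS); last by move=> j; exact: cl_hpoly_derive hY.
by rewrite Y0 scaler0 add0r -scalerDl.
Qed.

(* On a ray through a point where [x Y(x)] does not vanish the eigenvalue equation
   is the ordinary differential equation for [Q]. *)
Lemma odd_eigen_ode c chi x0 : H x0 != 0 ->
  (forall x, eball 1 x -> L_op c (odd_function Y Q) x = chi *: odd_function Y Q x) ->
  forall t, 0 < t < 1 ->
  (1 - t) * (2 * t * Q2 t + (2 + beta) * Q1 t) - (2 * t * Q1 t + beta * Q t)
  = ((2 * pi * c) ^+ 2 * t - chi) / 2 * Q t.
Proof.
move=> Hx0 eig t /andP[t0 t1].
have [A HA] : exists A, cl_coef (H x0) A != 0.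
  apply: contrapT => /forallNP HA; move: Hx0; apply/negP/negPn/eqP.
  by apply: cl_ext => A; rewrite cl_coef0; apply/eqP/negPn/negP/HA.
have r0 : 0 < dotv x0 x0.
  rewrite lt_neqAle dotvv_ge0 andbT eq_sym; apply: contra HA => /eqP r0.
  have -> : x0 = 0 *: x0.
    rewrite scale0r; apply/rowP => j; rewrite mxE; apply/eqP.
    by rewrite -sqrf_eq0 eq_le sqr_ge0 andbT -r0 coord_le_dotv.
  by rewrite (hpoly_scale _ _ (hH A)) expr0n mul0r.
pose s := Num.sqrt (t / dotv x0 x0); pose x := s *: x0.
have s0 : 0 < s by rewrite sqrtr_gt0 divr_gt0.
have xt : dotv x x = t.
  rewrite dotvZ dotvC dotvZ mulrA -expr2 sqr_sqrtr ?divfK ?gt_eqF//.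
  by rewrite ltW// divr_gt0.
have x1 : eball 1 x by rewrite eballE// xt expr1n ltW.
have := eig x x1; rewrite L_op_odd_function odd_functionE xt scalerA.
move=> /(congr1 (fun a => cl_coef a A)); rewrite !cl_coefZ => /mulIf.
have Hx : cl_coef (H x) A != 0.
  by rewrite /x (hpoly_scale s x0 (hH A)) mulf_neq0// expf_neq0// gt_eqF.
move=> /(_ Hx) E.
apply: (@mulfI _ (- 2)); first by rewrite oppr_eq0.
have -> : -2 * (((2 * pi * c) ^+ 2 * t - chi) / 2 * Q t) =
   chi * Q t - 4 * pi ^+ 2 * c ^+ 2 * t * Q t by field.
by rewrite -E; ring.
Qed.

End OddFunctions.

(** * The cosine transform of an odd eigenfunction *)

Section OddFunctionTransform.
Context (R : realType) (m k : nat) (Y : 'rV[R]_m -> clifford R m).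
Context (hY : cl_hpoly k Y) (Y0 : forall x, Defs.dirac Y x = 0).
Context (c chi : R) (Q : R -> R).

Lemma odd_function_lbm A : continuous Q -> lbm (fun x => cl_coef (odd_function Y Q x) A).
Proof.
move=> cQ.
rewrite (_ : (fun _ => _) = fun x => Q (dotv x x) * cl_coef (cl_vec x * Y x) A); last first.
  by apply/funext => x; rewrite odd_functionE cl_coefZ.
by apply: lbmM; [exact: lbm_radial|exact: hpoly_lbm (cl_hpoly_vecM hY A)].
Qed.

(** The factor [nu phi] is the same for every point and every Clifford coordinate; this allows the
    scalar identities to be reassembled into one eigenvalue equation. *)
Lemma odd_eigenpair_cosint : odd_eigenpair c Y chi Q ->
  exists nu : R -> R, forall phi x A, eball 1 x ->
    Rn_integral (eball 1)
      (fun y => cos (2 * pi * c * dotv x y + phi) * cl_coef (odd_function Y Q y) A)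
    = nu phi * cl_coef (odd_function Y Q x) A.
Proof.
move=> [sQ [t0 t01 Qt0] eig].
pose H (x : 'rV[R]_m) := cl_vec x * Y x.
(* If [x Y] vanishes identically, the eigenvalue equation carries no information on [Q], but both
   sides of the claim are 0. *)
have [H0|/existsNP[x0 Hx0]] := pselect (forall x, H x = 0).
  have f0 x : odd_function Y Q x = 0 by rewrite odd_functionE [_ * _]H0 scaler0.
  exists (fun=> 0) => phi x A _; rewrite mul0r ballint0// => y.
  by rewrite f0 cl_coef0 mulr0.
have dQ (s : R) : is_derive s 1 Q (Q^`() s).
  by rewrite derive1E; exact/derivableP/(sQ 0%N).
have dQ1 (s : R) : is_derive s 1 (Q^`()) (Q^`(2) s).
  by rewrite derive1nS derive1E; exact/derivableP/(sQ 1%N).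
have ode := odd_eigen_ode hY Y0 dQ dQ1 (introN eqP Hx0) eig.
set a := 2 * pi * c in ode.
have a0 : 0 <= a ^+ 2 by exact: sqr_ge0.
have Q00 : Q 0 != 0.
  apply: contra Qt0 => /eqP Q00; apply/eqP.
  apply: (radial_profile_eq0 dQ dQ1 ode a0 Q00 (t := t0)).
  by move: t01; rewrite inE /= in_itv.
exists (fun phi => a ^+ k.+1 * (cosint1 (phi - k.+1%:R * (pi / 2))
  (primitives Q (Q^`()) k.+2) (0 : 'rV[R]_m) / Q 0)) => phi x A x1.
have xx1 : dotv x x <= 1 by move: x1; rewrite eballE// expr1n.
have hHA := cl_hpoly_vecM hY A.
transitivity (cosint phi (primitives Q (Q^`()) 1) (fun y => cl_coef (H y) A) (a *: x)).
  apply: eq_ballint => y.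
  by rewrite odd_functionE cl_coefZ dotvZ mulrA.
have cK n : continuous (primitives Q (Q^`()) n.+1).
  apply (@continuous_primitives R Q _ _ dQ dQ1 n.+1).
have dK n (s : R) : 0 <= s <= 1 -> is_derive s 1 (primitives Q (Q^`()) n.+2)
    (primitives Q (Q^`()) n.+1 s / 2).
  exact: is_derive_primitives.
rewrite (cosint_harmonic (J := fun n => primitives Q (Q^`()) n.+1) cK dK
  (@primitives_at1 _ Q (Q^`())) 0%N phi (a *: x) hHA (harmonic_vec_monogenic hY Y0 A)).
have := radial_profile dQ dQ1 ode a0 erefl (phi - k.+1%:R * (pi / 2)) xx1.
rewrite add0n (hpoly_scale a x hHA) odd_functionE cl_coefZ -/(cosint1 _ _ _) /H.
set u := cosint1 _ _ _; set v := cosint1 _ _ _ => uv.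
apply: (mulfI Q00); rewrite mulrCA [_ * u]uv.
by field.
Qed.

End OddFunctionTransform.

(** * From cosine transforms to the operators [G_c] and [Q P_c] *)

Section FourierTransforms.
Context (R : realType) (m : nat) (c : R) (c0 : 0 < c).
Implicit Types g h : 'rV[R]_m -> R.

Lemma Rn_integral_scale g h : lbm h -> (forall y, eball 1 y -> g (c *: y) = h y) ->
  Rn_integral (eball c) g = c ^+ m * Rn_integral (eball 1) h.
Proof.
move=> lh gh; rewrite /Rn_integral [in LHS]Rintegral_mkcond [in RHS]Rintegral_mkcond.
have ic0 : 0 < c^-1 by rewrite invr_gt0.
have mB := measurable_eball (m := m) (@ler01 R).
rewrite [in RHS](integral_affine (fun=> 0) ic0); last first.
  have /(integrable_mkcond _ mB) := lbm_integrable (@ler01 R) lh.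
  by rewrite restrict_EFin.
rewrite mulrA -exprMn divff ?gt_eqF// expr1n mul1r.
apply: eq_Rintegral => t _; set u := tuple_affine _ _ _.
have tu : row_of_tuple t = c *: row_of_tuple u.
  by rewrite row_of_tuple_scale scalerA divff ?gt_eqF// scale1r.
have Bu : eball c (row_of_tuple t) <-> eball 1 (row_of_tuple u).
  by rewrite tu -[X in eball X _]mulr1; exact: eballZ.
rewrite /patch; case: ifPn => [/set_mem/Bu Bt|/negP Bt].
  by rewrite mem_set// tu gh.
by rewrite memNset// => /Bu/mem_set.
Qed.

Context (psi f : 'rV[R]_m -> clifford R m).
Context (f_lbm : forall A, lbm (fun x => cl_coef (f x) A)).
Context (psi_in : forall x, eball 1 x -> psi x = f x).
Context (psi_out : forall x, ~ eball 1 x -> psi x = 0).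
Context (nu : R -> R).
Context (nuE : forall phi x A, eball 1 x ->
    Rn_integral (eball 1)
      (fun y => cos (2 * pi * c * dotv x y + phi) * cl_coef (f y) A)
    = nu phi * cl_coef (f x) A).

Let sin_cos (t : R) : sin t = cos (t + - (pi / 2)).
Proof. by rewrite cosB cos_pihalf sin_pihalf mulr0 mulr1 add0r. Qed.

Let ball_indic (x : 'rV[R]_m) : eball 1 x -> \1_(eball 1) x = 1 :> R[i].
Proof. by move=> x1; rewrite indicE mem_set. Qed.

Let mulC_real (a b r : R) : (a +i* b)%C * r%:C%C = (a * r +i* (b * r))%C.
Proof. by simpc. Qed.

Let mulCE (a b r s : R) : (a +i* b)%C * (r +i* s)%C = ((a * r - b * s) +i* (a * s + b * r))%C.
Proof. by []. Qed.

Let nu0 := nu 0.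
Let nu1 := nu (- (pi / 2)).

Let cos_lbm x A : lbm (fun y => cos (2 * pi * c * dotv x y) * cl_coef (f y) A).
Proof.
apply: lbmM => //.
rewrite (_ : (fun _ => _) = fun y => cos (dotv ((2 * pi * c) *: x) y + 0)).
  exact: lbm_cos.
by apply/funext => y; rewrite dotvZ addr0.
Qed.

Let sin_lbm x A : lbm (fun y => sin (2 * pi * c * dotv x y) * cl_coef (f y) A).
Proof.
apply: lbmM => //.
rewrite (_ : (fun _ => _) = fun y => cos (dotv ((2 * pi * c) *: x) y + - (pi / 2))).
  exact: lbm_cos.
by apply/funext => y; rewrite dotvZ sin_cos.
Qed.

Let cosE x A : eball 1 x ->
  Rn_integral (eball 1) (fun y => cos (2 * pi * c * dotv x y) * cl_coef (f y) A)
  = nu0 * cl_coef (f x) A.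
Proof.
move=> x1; rewrite -nuE//; apply: eq_ballint => y; by rewrite addr0.
Qed.

Let sinE x A : eball 1 x ->
  Rn_integral (eball 1) (fun y => sin (2 * pi * c * dotv x y) * cl_coef (f y) A)
  = nu1 * cl_coef (f x) A.
Proof.
by move=> x1; rewrite -nuE//; apply: eq_ballint => y; rewrite sin_cos.
Qed.

Let eq_ballint_in g h : (forall y, eball 1 y -> g y = h y) ->
  Rn_integral (eball 1) g = Rn_integral (eball 1) h.
Proof.
by move=> gh; apply: eq_Rintegral => t /set_mem; exact: gh.
Qed.

(** The coordinates of [psi] are real, so the cosine and sine integrals are the real and imaginary
    parts; the phases 0 and [- pi / 2] give those of the eigenvalue. *)
Lemma G_op_eigenfunction x : eball 1 x ->
  G_op c (complexify psi) x = (nu0 +i* nu1)%C *: complexify psi x.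
Proof.
move=> x1; rewrite /G_op ball_indic// scale1r; apply: cl_ext => A.
rewrite cl_coefZ !cl_mkE psi_in//.
rewrite mulC_real -cosE// -sinE//; by congr Complex; apply: eq_ballint_in => y y1;
  rewrite cl_coefZ cl_mkE psi_in// mulC_real.
Qed.

(** Since [psi] is supported in the unit ball, this is the integral of [G_c] with the exponent
    negated, which conjugates the eigenvalue. *)
Let fourier_scaled x : eball 1 x ->
  fourier (complexify psi) (c *: x) =
  (nu0 +i* (- nu1))%C *: complexify f x.
Proof.
move=> x1; apply: cl_ext => A; rewrite cl_coefZ !cl_mkE.
rewrite mulC_real mulNr.
have supp g h : (forall y, eball 1 y -> g y = h y) -> (forall y, ~ eball 1 y -> g y = 0) ->
    Rn_integral setT g = Rn_integral (eball 1) h.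
  move=> gh g0; rewrite -(eq_ballint_in gh) /Rn_integral [RHS]Rintegral_mkcond.
  apply: eq_Rintegral => t _; rewrite /patch; case: ifPn => // /negP Bt.
  by rewrite g0// => /mem_set.
rewrite -cosE// -sinE// -ballintN//.
have th y : - (2 * pi * dotv y (c *: x)) = - (2 * pi * c * dotv x y).
  by rewrite dotvC dotvZ; ring.
by congr Complex; apply: supp => y y1; rewrite cl_coefZ cl_mkE ?(psi_in y1) ?(psi_out y1)
  mulC_real/= ?cl_coef0 ?mulr0// th ?cosN// sinN mulNr.
Qed.

Lemma space_band_limit_eigenfunction x : eball 1 x ->
  space_limit (band_limit c (complexify psi)) x =
  (c ^+ m * (nu0 ^+ 2 + nu1 ^+ 2))%:C%C *: complexify psi x.
Proof.
move=> x1; rewrite /space_limit ball_indic// scale1r; apply: cl_ext => A.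
rewrite cl_coefZ !cl_mkE psi_in//.
pose C y := cos (2 * pi * c * dotv x y) * cl_coef (f y) A.
pose S y := sin (2 * pi * c * dotv x y) * cl_coef (f y) A.
have lC : lbm C by exact: cos_lbm.
have lS : lbm S by exact: sin_lbm.
have th y : 2 * pi * dotv (c *: y) x = 2 * pi * c * dotv x y.
  by rewrite dotvZ dotvC; ring.
(* Real part of the exponential times [(nu0 - i nu1) f(y)]; the imaginary part below is
   [nu0 S - nu1 C], whose two contributions cancel after integration. *)
rewrite (Rn_integral_scale (h := fun y => nu0 * C y + nu1 * S y)); last first.
- move=> y y1; rewrite cl_coefZ fourier_scaled// cl_coefZ cl_mkE th mulC_real mulCE /C /S /=.
  by ring.
- by apply: lbmD; apply: lbmM => //; exact: lbm_cst.
rewrite (Rn_integral_scale (h := fun y => nu0 * S y + - nu1 * C y)); last first.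
- move=> y y1; rewrite cl_coefZ fourier_scaled// cl_coefZ cl_mkE th mulC_real mulCE /C /S /=.
  by ring.
- by apply: lbmD; apply: lbmM => //; exact: lbm_cst.
rewrite !ballintD; try (by apply: lbmM => //; exact: lbm_cst).
rewrite !ballintZ// cosE// sinE//.
by rewrite mulC_real mul0r; congr Complex; ring.
Qed.

End FourierTransforms.

Local Close Scope classical_set_scope.

Theorem theorem5p9 (R : realType) (m : nat) (c : R)
    (hm : (2 <= m)%N) (hc : 0 < c) (N k : nat)
    (Y : 'I_(monogenic_rank m k) -> 'rV[R]_m -> clifford R m)
    (hY : monogenic_basis Y) (hYo : sphere_orthonormal Y)
    (i : 'I_(monogenic_rank m k)) (psi : 'rV[R]_m -> clifford R m)
    (hpsi : odd_cpswf c (Y i) N psi) :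
  (exists lambda : R[i], forall x, eball 1 x ->
     space_limit (band_limit c (complexify psi)) x = lambda *: complexify psi x)
  /\
  (exists mu : R[i], forall x, eball 1 x ->
     G_op c (complexify psi) x = mu *: complexify psi x).
Proof.
have [/homogeneous_poly_hpoly hYi Yi0] := hY.1 i.
have [chi [Q [_ pairQ psi_in psi_out _]]] := hpsi.
have [sQ _ _] := pairQ.
have cQ : continuous Q.
  by move=> s; apply: differentiable_continuous; apply/derivable1_diffP; exact: (sQ 0%N).
have [nu nuE] := odd_eigenpair_cosint hYi Yi0 pairQ.
have fl A := odd_function_lbm hYi A cQ.
split; eexists => x x1.
- exact: space_band_limit_eigenfunction nuE _ x1.
- exact: G_op_eigenfunction nuE _ x1.
Qed.
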